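(* Let $P,Q$ be orthogonal projections in a $W^*$-probability space $(\mathscr{A},\tau)$ and let $(U_t)_{t\ge 0}$ be a free unitary Brownian motion in $(\mathscr{A},\tau)$, freely independent from $\{P,Q\}$. For every $t>0$, the spectral distribution $\mu_t$ (with respect to $\tau$) of the self-adjoint operator $PU_tQU_t^*P$ is given by $$\mu_t=(1-\min\{\tau(P),\tau(Q)\})\,\delta_{0}+\max\{\tau(P)+\tau(Q)-1,0\}\,\delta_1+\frac{\kappa_t(2\arccos(\sqrt{x}))}{2\pi\sqrt{x(1-x)}}\,\mathbf{1}_{[0,1]}(x)\,dx,$$ where $\kappa_t$ is the density, with respect to the normalized Lebesgue measure on the unit circle, of the absolutely continuous measure $\nu_t-a\delta_\pi-b\delta_0$ associated with the symmetries $R=2P-I$ and $S=2Q-I$ (see context for $\nu_t,a,b$).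
   Context: A $W^*$-probability space $(\mathscr{A},\tau)$ is a von Neumann algebra with a faithful normal tracial state $\tau$. A free unitary Brownian motion $(U_t)_{t\ge0}$ is a family of unitaries with $U_0=I$ and free, stationary multiplicative increments such that the law of $U_t$ is the probability measure $\lambda_t$ on $\mathbb{T}$ with moments $$\int_{\mathbb{T}}\zeta^k\,d\lambda_t(\zeta)=\tau(U_t^k)=e^{-kt/2}\sum_{j=0}^{k-1}\frac{(-t)^j}{j!}\binom{k}{j+1}k^{j-1},\qquad k\ge 1.$$ ''$(U_t)$ freely independent from $\{P,Q\}$'' means that $\{P,Q\}$ and $\{U_t,U_t^*\}$ are free for $\tau$. The unit circle $\mathbb{T}$ is identified with $(-\pi,\pi]$ via $\theta\mapsto e^{i\theta}$, so $\delta_\pi$ and $\delta_0$, as measures on $\mathbb{T}$, are the Dirac masses at $-1$ and $1$; functions on $\mathbb{T}$ are viewed as functions of $\theta\in(-\pi,\pi]$. The normalized Lebesgue measure on $\mathbb{T}$ is $d\theta/2\pi$. (In the formula for $\mu_t$, $\delta_0$ and $\delta_1$ are Dirac masses at the points $0,1\in[0,1]$.) For the symmetries (self-adjoint unitaries) $R=2P-I$, $S=2Q-I$, put $\alpha=\tau(R)$, $\beta=\tau(S)$, $a=|\alpha-\beta|/2$, $b=|\alpha+\beta|/2$. The measure $\nu_t$ is the spectral distribution on $\mathbb{T}$ of the unitary $RU_tSU_t^*$, i.e. $\int_{\mathbb{T}}\zeta^n\,d\nu_t(\zeta)=\tau((RU_tSU_t^* )^n)$ for all $n\in\mathbb{Z}$.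 For every $t>0$ the measure $\nu_t-a\delta_\pi-b\delta_0$ is absolutely continuous with respect to $d\theta/2\pi$, and $\kappa_t$ denotes its density. The function $\arccos$ takes values in $[0,\pi]$. *)

(* Defs.v *)
From mathcomp Require Import all_boot all_order all_algebra.
From mathcomp Require Import complex.
From mathcomp Require Import all_classical all_reals all_analysis.

Set Implicit Arguments.
Unset Strict Implicit.
Unset Printing Implicit Defensive.

Import Order.TTheory GRing.Theory Num.Theory.
Import numFieldNormedType.Exports.

Local Open Scope classical_set_scope.
Local Open Scope complex_scope.
Local Open Scope ring_scope.

(* The inner product is linear in the first variable and conjugate-linear in
   the second. *)
Record hilbertSpace (R : realType) := HilbertSpace {
  hilbert_sort :> lmodType R[i];
  inner : {dot hilbert_sort for @Num.conj R[i]};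
  hilbert_complete : forall u : nat -> hilbert_sort,
    (forall e : R, 0 < e -> exists N : nat, forall m n : nat,
       (N <= m)%N -> (N <= n)%N -> inner (u m - u n) (u m - u n) < e%:C) ->
    exists l : hilbert_sort, forall e : R, 0 < e ->
      exists N : nat, forall n : nat,
        (N <= n)%N -> inner (u n - l) (u n - l) < e%:C }.

Definition bounded_operator (R : realType) (H : hilbertSpace R)
    (T : {linear H -> H}) : Prop :=
  exists M : R, forall v : H, inner H (T v) (T v) <= M%:C * inner H v v.

(* A von Neumann algebra: a unital *-algebra of bounded operators on a complex
   Hilbert space, closed for the weak operator topology. The algebra is carried
   by an algType whose elements are identified with operators through the
   injective map vn_op. By vn_adjoint and vn_op_inj, the involution is the
   operator adjoint and is determined by vn_op. *)
Record vonNeumannAlgebra (R : realType) := VonNeumannAlgebra {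
  vn_sort :> algType R[i];
  vn_star : vn_sort -> vn_sort;
  vn_space : hilbertSpace R;
  vn_op : vn_sort -> {linear vn_space -> vn_space};
  vn_op_inj : forall x y : vn_sort, vn_op x =1 vn_op y -> x = y;
  vn_op_bounded : forall x : vn_sort, bounded_operator (vn_op x);
  vn_op1 : forall v : vn_space, vn_op 1 v = v;
  vn_opM : forall (x y : vn_sort) (v : vn_space),
    vn_op (x * y) v = vn_op x (vn_op y v);
  vn_opD : forall (x y : vn_sort) (v : vn_space),
    vn_op (x + y) v = vn_op x v + vn_op y v;
  vn_opZ : forall (c : R[i]) (x : vn_sort) (v : vn_space),
    vn_op (c *: x) v = c *: vn_op x v;
  vn_adjoint : forall (x : vn_sort) (v w : vn_space),
    inner vn_space (vn_op x v) w = inner vn_space v (vn_op (vn_star x) w);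
  vn_weakly_closed : forall T : {linear vn_space -> vn_space},
    bounded_operator T ->
    (forall (n : nat) (v w : 'I_n -> vn_space) (e : R), 0 < e ->
       exists x : vn_sort, forall k : 'I_n,
         `|inner vn_space (vn_op x (v k) - T (v k)) (w k)| < e%:C) ->
    exists x : vn_sort, vn_op x =1 T }.

Definition self_adjoint (R : realType) (A : vonNeumannAlgebra R) (x : A) : Prop :=
  vn_star x = x.

Definition is_projection (R : realType) (A : vonNeumannAlgebra R) (x : A) : Prop :=
  self_adjoint x /\ x * x = x.

Definition is_unitary (R : realType) (A : vonNeumannAlgebra R) (x : A) : Prop :=
  vn_star x * x = 1 /\ x * vn_star x = 1.

Definition op_le (R : realType) (A : vonNeumannAlgebra R) (x y : A) : Prop :=
  forall v : vn_space A,
    inner (vn_space A) (vn_op x v) v <= inner (vn_space A) (vn_op y v) v.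

Definition is_op_lub (R : realType) (A : vonNeumannAlgebra R)
    (D : set A) (s : A) : Prop :=
  [/\ self_adjoint s, (forall d, D d -> op_le d s) &
      forall y : A, self_adjoint y -> (forall d, D d -> op_le d y) -> op_le s y].

Record wstarProbabilitySpace (R : realType) := WstarProbabilitySpace {
  wps_algebra :> vonNeumannAlgebra R;
  wps_state : {scalar wps_algebra};
  wps_state1 : wps_state 1 = 1;
  wps_state_ge0 : forall x : wps_algebra, 0 <= wps_state (vn_star x * x);
  wps_state_tracial : forall x y : wps_algebra,
    wps_state (x * y) = wps_state (y * x);
  wps_state_faithful : forall x : wps_algebra,
    wps_state (vn_star x * x) = 0 -> x = 0;
  wps_state_normal : forall (D : set wps_algebra) (s : wps_algebra),
    D !=set0 -> (forall x, D x -> self_adjoint x) ->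
    (forall x y, D x -> D y -> exists z, [/\ D z, op_le x z & op_le y z]) ->
    is_op_lub D s ->
    complex.Re (wps_state s) = sup [set complex.Re (wps_state x) | x in D] }.

Notation state := (@wps_state _ _).

Definition unital_star_subalgebra (R : realType) (A : vonNeumannAlgebra R)
    (B : set A) : Prop :=
  [/\ B 1,
      (forall (c : R[i]) (x y : A), B x -> B y -> B (c *: x + y)),
      (forall x y : A, B x -> B y -> B (x * y)) &
      (forall x : A, B x -> B (vn_star x))].

Definition generated_algebra (R : realType) (A : vonNeumannAlgebra R)
    (G : set A) : set A :=
  smallest (@unital_star_subalgebra R A) G.

Definition free_family (R : realType) (A : wstarProbabilitySpace R)
    (I : Type) (G : I -> set A) : Prop :=
  forall (n : nat) (i : nat -> I) (x : nat -> A),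
    (forall k, (k <= n)%N -> generated_algebra (G (i k)) (x k)) ->
    (forall k, (k <= n)%N -> state (x k) = 0) ->
    (forall k, (k < n)%N -> i k <> i k.+1) ->
    state (\prod_(0 <= k < n.+1) x k) = 0.

Definition free_pair (R : realType) (A : wstarProbabilitySpace R)
    (G1 G2 : set A) : Prop :=
  free_family (fun b : bool => if b then G1 else G2).

Definition free_ubm_moment (R : realType) (t : R) (k : nat) : R :=
  expR (- (k%:R * t / 2)) *
  \sum_(j < k) ((- t) ^+ j / j`!%:R * 'C(k, j.+1)%:R * k%:R ^ (j%:Z - 1)).

(* The law of a unitary is given by its moments of positive order, those of
   negative order being their conjugates. *)
Definition free_unitary_brownian_motion (R : realType)
    (A : wstarProbabilitySpace R) (U : R -> A) : Prop :=
  [/\ (forall t, 0 <= t -> is_unitary (U t)) /\ U 0 = 1,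
      (forall (n : nat) (s : nat -> R), 0 <= s 0%N ->
         (forall k, (k < n)%N -> s k < s k.+1) ->
         free_family (fun k : 'I_n =>
           [set U (s k.+1) * vn_star (U (s k));
                vn_star (U (s k.+1) * vn_star (U (s k)))])),
      (forall s t, 0 <= s -> s <= t -> forall k : nat,
         state ((U t * vn_star (U s)) ^+ k) = state (U (t - s) ^+ k)) &
      (forall t, 0 <= t -> forall k : nat, (1 <= k)%N ->
         state (U t ^+ k) = (free_ubm_moment t k)%:C)].

(* The unit circle, identified with (-pi, pi] through theta |-> e^(i theta). *)
Definition circle (R : realType) : set R := [set` `]-pi, pi]].
Arguments circle R : clear implicits.

Definition unitary_exp (R : realType) (A : vonNeumannAlgebra R)
    (x : A) (n : int) : A :=
  match n with
  | Posz m => x ^+ m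
  | Negz m => vn_star x ^+ m.+1
  end.

Definition circle_moment (R : realType) (nu : probability (measurableTypeR R) R)
    (n : int) : R[i] :=
  (\int[nu]_(theta in circle R) cos (n%:~R * theta))%R +i*
  (\int[nu]_(theta in circle R) sin (n%:~R * theta))%R.

Definition unitary_spectral_distribution (R : realType)
    (A : wstarProbabilitySpace R) (x : A)
    (nu : probability (measurableTypeR R) R) : Prop :=
  nu (circle R) = 1%E /\
  forall n : int, circle_moment nu n = state (unitary_exp x n).

(* The compactly supported probability measure on the line with the moments
   of x. *)
Definition self_adjoint_spectral_distribution (R : realType)
    (A : wstarProbabilitySpace R) (x : A)
    (mu : probability (measurableTypeR R) R) : Prop :=
  (exists M : R, mu [set` `[- M, M]] = 1%E) /\
  forall n : nat, (\int[mu]_y (y ^+ n))%R%:C = state (x ^+ n).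

Definition is_circle_density (R : realType) (m : set R -> \bar R)
    (kappa : R -> R) : Prop :=
  (@lebesgue_measure R).-integrable (circle R) (EFin \o kappa) /\
  forall B : set (measurableTypeR R), measurable B -> B `<=` circle R ->
    m B = (((2 * pi)^-1)%:E *
           \int[@lebesgue_measure R]_(theta in B) (kappa theta)%:E)%E.

Definition real_state (R : realType) (A : wstarProbabilitySpace R) (x : A) : R :=
  complex.Re (state x).

Definition symmetry_of (R : realType) (A : vonNeumannAlgebra R) (x : A) : A :=
  2 *: x - 1.

(* nu - a delta_pi - b delta_0 *)
Definition circle_ac_part (R : realType) (A : wstarProbabilitySpace R)
    (P Q : A) (nu : probability (measurableTypeR R) R) (B : set R) : \bar R :=
  let alpha := real_state (symmetry_of P) in
  let beta := real_state (symmetry_of Q) in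
  let a : R := `|alpha - beta| / 2 in
  let b : R := `|alpha + beta| / 2 in
  (nu B - a%:E * dirac (pi : R) B - b%:E * dirac (0%R : R) B)%E.

(* Main.v *)
(* The proof uses only that U_t is unitary, so that Q' = U_t Q U_t^-1 is again a
   projection with the trace of Q.  Put T = 1 - (P - Q')^2.  It commutes with P
   and Q', P Q' P = P T, and T = (2 + V + V^-1) / 4 with V = R S', S' = 2 Q' - 1; hence T is
   c(theta) = (1 + cos theta) / 2 = cos^2 (theta / 2) evaluated at V, and
   traciality gives, for n >= 1,
     tau ((P Q' P)^n) = (\int c^n dnu + tau P + tau Q - 1) / 2.
   Compactly supported measures are determined by their moments, so the
   spectral distribution is, up to atoms at 0 and 1, half the image of nu by c.
   The two halves ]0, pi[ and ]-pi, 0[ of the circle have the same image: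
   tau (T^n V) = tau (T^n V^-1) kills the moments \int c^n sin dnu, and |sin| is a
   function of c.  Finally c maps (sin theta / 2) dtheta on ]0, pi[ to Lebesgue
   measure on ]0, 1[, again by comparing moments, which yields the density. *)

From HB Require Import structures.
Require Import Defs.
From mathcomp Require Import all_boot all_order all_algebra.
From mathcomp Require Import complex ring lra.
From mathcomp Require Import all_classical all_reals all_analysis.
From mathcomp Require Import measurable_realfun.
Import Order.TTheory GRing.Theory Num.Theory.
Import numFieldNormedType.Exports.
Local Open Scope classical_set_scope.
Local Open Scope ring_scope.

(** * Traces of compressions *)

(** For idempotents this is [1 - (P - Q) ^+ 2], the squared cosine of the operator angle between [P]
    and [Q]. The expanded form is visibly symmetric and can be traced term by term. *)
Definition cos2_half (B : pzRingType) (P Q : B) : B := 1 - P - Q + P * Q + Q * P.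

Lemma cos2_halfC (B : pzRingType) (P Q : B) : cos2_half B P Q = cos2_half B Q P.
Proof. by rewrite /cos2_half [LHS]addrAC (addrAC 1 (- P)). Qed.

Lemma mul_cos2_half (B : pzRingType) (P Q : B) : P * P = P ->
  P * cos2_half B P Q = P * Q * P.
Proof.
by move=> PP; rewrite /cos2_half !mulrDr !mulrN mulr1 !mulrA PP subrr add0r addNr add0r.
Qed.

Lemma comm_cos2_half (B : pzRingType) (P Q : B) : P * P = P ->
  P * cos2_half B P Q = cos2_half B P Q * P.
Proof.
move=> PP; rewrite mul_cos2_half// /cos2_half !mulrDl !mulNr mul1r.
by rewrite -[Q * P * P]mulrA PP subrr add0r addrAC addNr add0r.
Qed.

(** [P] commutes with [cos2_half B P Q] and equals its own positive powers. The exponent has to be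
    positive: at exponent 0 the two sides would be [1] and [P]. *)
Lemma compression_exp (B : pzRingType) (P Q : B) (n : nat) : P * P = P ->
  (P * Q * P) ^+ n.+1 = P * cos2_half B P Q ^+ n.+1.
Proof.
move=> PP; rewrite -mul_cos2_half// exprMn_comm; last exact: comm_cos2_half.
by congr (_ * _); elim: n => [|n IH]; rewrite ?expr1// exprSr IH.
Qed.

(* With [u n = tau (P T^n)], expanding [T = 1 - P - Q + P Q + Q P] shows that
   [2 u n - tau (T^n)] does not depend on [n >= 1]. *)
Lemma trace_compression_exp (C : numFieldType) (B : algType C) (tau : {scalar B})
    (P Q : B) (n : nat) :
    (forall x y, tau (x * y) = tau (y * x)) -> P * P = P -> Q * Q = Q ->
  tau ((P * Q * P) ^+ n.+1) =
    (tau (cos2_half B P Q ^+ n.+1) + tau P + tau Q - tau 1) / 2.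
Proof.
move=> tauC PP QQ; set T := cos2_half B P Q.
have cPT m : P * T ^+ m = T ^+ m * P by apply/commrX/comm_cos2_half.
have cQT m : Q * T ^+ m = T ^+ m * Q.
  by apply/commrX; rewrite /GRing.comm /T cos2_halfC; exact: comm_cos2_half.
(* Only cyclic rotation and the commutation of [P] with [T] are involved here. *)
have QPE m : tau (Q * P * T ^+ m) = tau (P * Q * T ^+ m).
  by rewrite -(mulrA _ P) cPT mulrA tauC mulrA.
have PE m : tau (P * T ^+ m.+1) = tau (P * Q * T ^+ m).
  by rewrite exprS mulrA mul_cos2_half// -(mulrA _ P) cPT mulrA tauC !mulrA PP.
have QE m : tau (Q * T ^+ m.+1) = tau (P * Q * T ^+ m).
  rewrite exprS mulrA /T cos2_halfC mul_cos2_half// cos2_halfC -/T.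
  by rewrite -[Q * P * Q * _]mulrA tauC cQT mulrA -(mulrA _ Q Q) QQ -(mulrA _ Q P) tauC QPE.
have TE m : tau (T ^+ m.+1) = tau (T ^+ m) - tau (P * T ^+ m) - tau (Q * T ^+ m)
    + (tau (P * Q * T ^+ m)) *+ 2.
  rewrite exprS {1}/T /cos2_half !mulrDl !mulNr mul1r !linearD !linearN QPE.
  by rewrite mulr2n !addrA.
(* The base case fixes the constant: at [T ^+ 0] the traces of [P] and [Q] may differ. From exponent
   1 on, [PE] and [QE] give [P] and [Q] the same trace against powers of [T]. *)
have E m : tau (P * T ^+ m.+1) *+ 2 = tau (T ^+ m.+1) + tau P + tau Q - tau 1.
  elim: m => [|m IH].
    by rewrite PE TE expr0 !mulr1; ring.
  have Qm : tau (Q * T ^+ m.+1) = tau (P * T ^+ m.+1) by rewrite PE QE.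
  rewrite TE Qm -PE.
  have -> : tau (T ^+ m.+1) = tau (P * T ^+ m.+1) *+ 2 - tau P - tau Q + tau 1.
    by rewrite IH; ring.
  by ring.
by rewrite compression_exp// -/T -E -[tau _ *+ 2]mulr_natr mulfK// pnatr_eq0.
Qed.

(** * Algebraic rules for the adjoint; projections and symmetries *)

Section star.
Variables (R : realType) (A : vonNeumannAlgebra R).
Local Notation H := (vn_space A).
Implicit Types x y : A.

(** The inner product is definite and [vn_op] is injective, so the adjoint relation determines the
    involution. The record postulates only that relation; the rules of a *-algebra below are all
    read off from this uniqueness. *)
Lemma vn_star_unique x y :
  (forall v w : H, inner H (vn_op x v) w = inner H v (vn_op y w)) -> vn_star x = y.
Proof.
move=> xy; apply: vn_op_inj => w.
apply/eqP; rewrite -subr_eq0 -(dnorm_eq0 (inner H)) linearBr/= subr_eq0.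
by rewrite -vn_adjoint xy.
Qed.

Lemma inner_conj (v w : H) : inner H v w = Num.conj (inner H w v).
Proof. by rewrite hermC/= expr0 mul1r. Qed.

Lemma vn_starK x : vn_star (vn_star x) = x.
Proof.
by apply: vn_star_unique => v w; rewrite inner_conj -vn_adjoint -inner_conj.
Qed.

Lemma vn_starM x y : vn_star (x * y) = vn_star y * vn_star x.
Proof. by apply: vn_star_unique => v w; rewrite !vn_opM -!vn_adjoint. Qed.

Lemma vn_star1 : vn_star (1 : A) = 1.
Proof. by apply: vn_star_unique => v w; rewrite !vn_op1. Qed.

Lemma vn_starD x y : vn_star (x + y) = vn_star x + vn_star y.
Proof.
by apply: vn_star_unique => v w; rewrite !vn_opD linearDl linearDr/= -!vn_adjoint.
Qed.

Lemma vn_starZ (c : R[i]) x : vn_star (c *: x) = Num.conj c *: vn_star x.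
Proof.
apply: vn_star_unique => v w.
by rewrite !vn_opZ linearZl_LR linearZr_LR/= conjCK -vn_adjoint.
Qed.

Lemma vn_starN x : vn_star (- x) = - vn_star x.
Proof. by rewrite -scaleN1r vn_starZ rmorphN rmorph1 scaleN1r. Qed.

Lemma projection_conj (u p : A) : Defs.is_unitary u -> is_projection p ->
  is_projection (u * p * vn_star u).
Proof.
move=> [u1 u2] [sp pp]; split; first by rewrite /self_adjoint !vn_starM vn_starK sp mulrA.
by rewrite !mulrA -(mulrA _ (vn_star u)) u1 mulr1 -(mulrA _ p p) pp.
Qed.

Lemma projection_onem (p : A) : is_projection p -> is_projection (1 - p).
Proof.
move=> [sp pp]; split; first by rewrite /self_adjoint vn_starD vn_starN vn_star1 sp.
by rewrite mulrBr mulr1 mulrBl mul1r pp subrr subr0.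
Qed.

Lemma symmetry_involutive (p : A) : is_projection p ->
  symmetry_of p * symmetry_of p = 1.
Proof.
move=> [_ pp]; have E : (2 *: p) * (2 *: p) = 2 *: p + 2 *: p.
  by rewrite -scalerAl -scalerAr pp scalerA -scalerDl; congr (_ *: _); ring.
by rewrite /symmetry_of mulrBr mulr1 mulrBl mul1r E addrK opprB addrC subrK.
Qed.

Lemma symmetry_self_adjoint (p : A) : is_projection p ->
  vn_star (symmetry_of p) = symmetry_of p.
Proof.
move=> [sp _]; rewrite /symmetry_of vn_starD vn_starZ sp vn_starN vn_star1.
by rewrite rmorphMn rmorph1.
Qed.

End star.

(** * Measures with a density *)

Section density.
Local Open Scope ereal_scope.
Context d (T : measurableType d) (R : realType).
Variables (mu : {sigma_finite_measure set T -> \bar R}) (w : T -> \bar R).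
Hypotheses (mw : measurable_fun [set: T] w) (w0 : forall x, 0 <= w x)
  (wfin : \int[mu]_x w x < +oo).

(** Packages the indefinite integral of [w] as a finite measure, so that Radon-Nikodym results can
    be applied to it. *)
Lemma exists_finite_density : exists m : {finite_measure set T -> \bar R},
  forall B, measurable B -> m B = \int[mu]_(x in B) w x.
Proof.
pose m (B : set T) := \int[mu]_(x in B) w x.
have m0 : m set0 = 0 by rewrite /m integral_set0.
have mge0 B : 0 <= m B by apply: integral_ge0.
have madd : semi_sigma_additive m.
  move=> F mF tF mUF; rewrite /m ge0_integral_bigcup//; last first.
    exact: measurable_funTS.
  by apply: is_cvg_ereal_nneg_natsum_cond => n _ _; exact: integral_ge0.
pose m_measure := isMeasure.Build _ _ _ m m0 mge0 madd.
pose mm := HB.pack_for {measure set T -> \bar R} m m_measure.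
have mfin : fin_num_fun mm.
  move=> B mB; rewrite ge0_fin_numE//= (le_lt_trans _ wfin)//.
  exact: ge0_subset_integral.
pose m_fin := Measure_isFinite.Build _ _ _ mm mfin.
by exists (HB.pack_for {finite_measure set T -> \bar R} m mm m_fin).
Qed.

(** [m] is dominated by [mu], and its Radon-Nikodym derivative has the same integral as [w] over
    every measurable set. The two therefore agree almost everywhere, and the change of variables
    formula for the derivative holds with [w]. *)
Lemma integral_density (m : {finite_measure set T -> \bar R})
    (hm : forall B, measurable B -> m B = \int[mu]_(x in B) w x)
    (f : T -> \bar R) (E : set T) :
    (forall x, 0 <= f x) -> measurable E -> measurable_fun E f ->
  \int[m]_(x in E) f x = \int[mu]_(x in E) (f x * w x).
Proof.
move=> f0 mE mf.
have mmu : m `<< mu.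
  apply/null_content_dominatesP => B mB B0; rewrite hm//.
  apply: null_set_integral => //; exact: measurable_funTS.
rewrite -(Radon_Nikodym_SigmaFinite.change_of_variables mmu)//.
have mRN := measurable_int _ (Radon_Nikodym_SigmaFinite.f_integrable mmu).
apply: ae_eq_integral => //.
- by apply: emeasurable_funM => //; exact: measurable_funTS.
- by apply: emeasurable_funM => //; exact: measurable_funTS.
apply: (ae_eq_comp2 (fun x y => f x * y)).
apply: ae_eq_subset (@subsetT _ E) _.
apply: integral_ae_eq => //.
  exact: Radon_Nikodym_SigmaFinite.f_integrable.
move=> B _ mB.
by rewrite -hm// -Radon_Nikodym_SigmaFinite.f_integral.
Qed.

End density.

(** The measure is the image by [c] of [w mu] restricted to [D]. The bound [w <= 1] on a set of
    finite measure makes it finite. It is described through its integrals, the form in which images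
    are compared below. *)
Lemma exists_pushforward_density d (T : measurableType d) (R : realType)
    (mu : {sigma_finite_measure set T -> \bar R}) (D : set T) (w c : T -> R) :
    measurable D -> (mu D < +oo)%E -> measurable_fun [set: T] w ->
    measurable_fun [set: T] c -> (forall t, D t -> 0 <= w t <= 1) ->
  exists m : {finite_measure set (measurableTypeR R) -> \bar R},
    forall (E : set (measurableTypeR R)) (f : R -> \bar R), measurable E ->
      measurable_fun [set: R] f -> (forall x, E x -> (0 <= f x)%E) ->
      (\int[m]_(x in E) f x =
       \int[mu]_(t in D `&` c @^-1` E) (f (c t) * (w t)%:E))%E.
Proof.
move=> mD muD mw mc w01.
pose v := (EFin \o w) \_ D.
have mv : measurable_fun [set: T] v.
  by apply/(measurable_restrictT _ mD)/measurable_funTS/measurable_EFinP.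
have v0 x : (0 <= v x)%E.
  rewrite /v patchE; case: ifPn => // /set_mem /w01 /andP[? _].
  by rewrite lee_fin.
have vfin : (\int[mu]_x v x < +oo)%E.
  rewrite -integral_mkcond.
  apply: (@le_lt_trans _ _ (\int[mu]_(x in D) 1)%E).
    apply: ge0_le_integral => //.
    - by move=> x /w01 /andP[? _]; rewrite lee_fin.
    - by apply/measurable_EFinP; exact: measurable_funTS.
    - by move=> x /w01 /andP[_ ?]; rewrite lee_fin.
  by rewrite integral_cst// mul1e.
have [m0 hm0] := exists_finite_density _ _ _ mu v mv v0 vfin.
pose pm0 : {measure set (measurableTypeR R) -> \bar R} :=
  pushforward m0 (c : T -> measurableTypeR R).
pose pm := pm0 mc.
have pmfin : fin_num_fun pm.
  move=> B mB; rewrite /pm /pm0/= /pushforward fin_num_measure//.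
  by rewrite -[X in measurable X]setTI; apply: (mc).
pose m_fin := Measure_isFinite.Build _ _ _ pm pmfin.
exists (HB.pack_for {finite_measure set (measurableTypeR R) -> \bar R} (Measure.sort pm) m_fin).
move=> E f mE mf f0.
(* [f] is nonnegative only on [E], so its extension by zero is what gets transported. *)
have mfE : measurable_fun [set: R] (f \_ E).
  by apply/(measurable_restrictT _ mE)/measurable_funTS.
have fE0 x : (0 <= (f \_ E) x)%E by apply: erestrict_ge0.
transitivity (\int[m0]_t ((f \_ E) \o c) t)%E.
  rewrite integral_mkcond; exact: ge0_integral_pushforward.
rewrite (integral_density _ _ _ mu v mv m0 hm0)//; last 2 first.
- by move=> x; exact: fE0.
- exact: measurableT_comp.
rewrite [RHS]integral_mkcond; apply: eq_integral => t _ /=.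
rewrite /v !patchE in_setI /preimage/= [c t \in E](_ : _ = (t \in c @^-1` E)); last first.
  by apply/idP/idP => /set_mem ?; apply/mem_set.
case: (t \in D); case: (t \in _); rewrite ?mule0 ?mul0e//.
Qed.

(** * Moment determinacy on a compact interval *)

Section moment_determinacy.
Variable R : realType.
Implicit Types (x y s r : R) (n N : nat).

(** Write [r = q ^+ 2]: one factor [q ^+ n] absorbs [n], and the other still decays
    geometrically. *)
Lemma cvg_natr_mul_exp r : 0 <= r < 1 -> n%:R * r ^+ n @[n --> \oo] --> (0 : R).
Proof.
move=> /andP[r0 r1]; pose q := Num.sqrt r.
have q0 : 0 <= q by exact: sqrtr_ge0.
have q1 : q < 1 by rewrite -sqrtr1 ltr_sqrt.
(* Each of the [n] terms of [1 + q + ... + q ^+ n.-1] is at least [q ^+ n], and the sum is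
   [(1 - q ^+ n) / (1 - q)]. *)
have qb n : n%:R * q ^+ n * (1 - q) <= 1 - q ^+ n.
  elim: n => [|n IH]; first by rewrite mul0r mul0r expr0 subrr.
  have : 0 <= q ^+ n <= 1 by rewrite exprn_ge0// exprn_ile1// ltW.
  have := ler_wpM2l q0 IH; rewrite -natr1 exprS => IH' /andP[a0 a1].
  have : 0 <= (1 - q) * (1 - q * q ^+ n).
    by rewrite mulr_ge0 ?subr_ge0 ?(ltW q1)// mulr_ile1// ltW.
  by move: IH'; lra.
have cq : q ^+ n / (1 - q) @[n --> \oo] --> (0 : R).
  rewrite -(mul0r (1 - q)^-1); apply: cvgMl.
  have := @cvg_geometric R 1 q; rewrite ger0_norm// => /(_ q1).
  by apply: cvg_trans; apply: near_eq_cvg; near=> n; rewrite /= mul1r.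
apply: (@squeeze_cvgr _ _ _ _ (fun=> 0) (fun n => q ^+ n / (1 - q))) => //.
  apply: nearW => n; apply/andP; split; first by rewrite mulr_ge0// exprn_ge0.
  rewrite ler_pdivlMr ?subr_gt0//.
  have -> : n%:R * r ^+ n * (1 - q) = (n%:R * q ^+ n * (1 - q)) * q ^+ n.
    by rewrite -(sqr_sqrtr r0) -/q -exprM mulnC exprM; ring.
  rewrite ler_piMl ?exprn_ge0// (le_trans (qb n))// gerBl exprn_ge0//.
exact: cvg_cst.
Unshelve. all: by end_near.
Qed.

Lemma bernoulli_onem x N : 0 <= x <= 1 -> 1 - N%:R * x <= (1 - x) ^+ N.
Proof.
move=> /andP[x0 x1]; elim: N => [|N IH]; first by rewrite mul0r subr0 expr0.
rewrite exprS -natr1; have := ler_wpM2l (_ : 0 <= 1 - x) IH.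
rewrite subr_ge0 => /(_ x1); have : 0 <= N%:R :> R by []; nra.
Qed.

(** By Bernoulli, [1 + N x <= (1 + x) ^+ N], and [(1 - x) (1 + x) <= 1]. *)
Lemma onem_exp_le x N : 0 <= x <= 1 -> (1 - x) ^+ N <= (1 + N%:R * x)^-1.
Proof.
move=> /andP[x0 x1]; have N0 : 0 <= N%:R * x by rewrite mulr_ge0.
rewrite -[leRHS]mul1r ler_pdivlMr ?ltr_pwDl//.
have B : 1 + N%:R * x <= (1 + x) ^+ N.
  elim: N {N0} => [|N IH]; first by rewrite mul0r addr0 expr0.
  rewrite exprS -natr1; have := ler_wpM2l (_ : 0 <= 1 + x) IH.
  by rewrite addr_ge0// => /(_ isT); have : 0 <= N%:R :> R by []; nra.
apply: (@le_trans _ _ ((1 - x) ^+ N * (1 + x) ^+ N)).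
  by rewrite ler_wpM2l// exprn_ge0// subr_ge0.
rewrite -exprMn; apply: exprn_ile1; nra.
Qed.

Definition step_degree s n := (n * (Num.truncn (s^-1 ^+ n)).+1)%N.

(* The multiplicity [step_degree s n] is chosen between [s^-n] and [y^-n] for
   every [y < s], so the polynomials converge pointwise to a step at [s]. *)
Lemma cvg_step_left s y : 0 < s <= 1 -> 0 <= y < s ->
  (1 - y ^+ n) ^+ step_degree s n @[n --> \oo] --> (1 : R).
Proof.
move=> /andP[s0 s1] /andP[y0 ys].
have y1 : y < 1 by exact: lt_le_trans s1.
have b n : 0 <= y ^+ n <= 1 by rewrite exprn_ge0// exprn_ile1// ltW.
(* Bernoulli's lower bound, with the degree bounded by [n * (s^-1 ^+ n + 1)]; both subtracted terms
   tend to 0 because [y < s] and [y < 1]. *)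
pose l n : R := 1 - (n%:R * (y / s) ^+ n + n%:R * y ^+ n).
apply: (@squeeze_cvgr _ _ _ _ l (fun=> 1)).
- apply: nearW => n; apply/andP; split; last first.
    by case/andP: (b n) => b0 b1; apply: exprn_ile1; rewrite ?subr_ge0// gerBl.
  apply: le_trans (bernoulli_onem _ _ (b n)); rewrite lerD2l lerN2.
  rewrite /step_degree natrM -mulrA -mulrDr ler_wpM2l// -natr1 mulrDl mul1r.
  rewrite lerD2r exprMn mulrC ler_wpM2l// ?exprn_ge0//.
  by rewrite truncn_le// exprn_ge0// invr_ge0 ltW.
- rewrite /l -[X in _ --> X]subr0; apply: cvgB; first exact: cvg_cst.
  rewrite -(addr0 0); apply: cvgD; apply: cvg_natr_mul_exp.
    by rewrite divr_ge0// ?ltW//= ltr_pdivrMr// mul1r.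
  by rewrite y0.
- exact: cvg_cst.
Qed.

Lemma cvg_step_right s y : 0 < s <= 1 -> s <= y <= 1 ->
  (1 - y ^+ n) ^+ step_degree s n @[n --> \oo] --> (0 : R).
Proof.
move=> /andP[s0 s1] /andP[sy y1]; have y0 : 0 < y by exact: lt_le_trans sy.
have b n : 0 <= y ^+ n <= 1 by rewrite exprn_ge0 ?(ltW y0)// exprn_ile1// ltW.
(* The degree times [y ^+ n] is at least [n], since [y >= s]. The factor [n] in [step_degree] thus
   forces decay like [1 / (n + 1)], also at [y = s]. *)
apply: (@squeeze_cvgr _ _ _ _ (fun=> 0) harmonic).
- apply: nearW => n; apply/andP; split.
    by case/andP: (b n) => b0 b1; rewrite exprn_ge0// subr_ge0.
  apply: le_trans (onem_exp_le _ _ (b n)) _.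
  rewrite /= lef_pV2 ?posrE//; last first.
    by rewrite ltr_pwDl// mulr_ge0// exprn_ge0// ltW.
  rewrite -natr1 addrC lerD2l /step_degree natrM -mulrA ler_peMr//.
  apply: (@le_trans _ _ (s^-1 ^+ n * y ^+ n)).
    by rewrite -exprMn exprn_ege1// mulrC ler_pdivlMr// mul1r.
  by rewrite ler_wpM2r ?exprn_ge0 ?ltW// truncnS_gt.
- exact: cvg_cst.
- exact: cvg_harmonic.
Qed.

Lemma bounded_integrable (m : {finite_measure set (measurableTypeR R) -> \bar R})
    (D : set (measurableTypeR R)) (f : R -> R) (M : R) :
    measurable D -> measurable_fun [set: R] f -> (forall x, D x -> `|f x| <= M) ->
  m.-integrable D (EFin \o f).
Proof.
move=> mD mf fM; apply: measurable_bounded_integrable => //.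
- by rewrite ltey_eq fin_num_measure.
- exact: measurable_funTS.
- by exists M; split; [exact: num_real|move=> z Mz x Dx; exact: le_trans (fM _ Dx) (ltW Mz)].
Qed.

Lemma horner_measurable (p : {poly R}) : measurable_fun [set: R] (fun x => p.[x]).
Proof.
elim/poly_ind: p => [|p c IH].
  by under eq_fun do rewrite horner0; exact: measurable_cst.
under eq_fun do rewrite hornerMXaddC.
by apply: measurable_funD => //; exact: measurable_funM.
Qed.

Lemma horner_bounded (p : {poly R}) (a b : R) :
  exists M, forall x, `[a, b]%classic x -> `|p.[x]| <= M.
Proof.
exists (\sum_(i < size p) `|p`_i| * (`|a| + `|b|) ^+ i) => x /=.
rewrite in_itv/= => /andP[ax xb].
rewrite horner_coef (le_trans (ler_norm_sum _ _ _))//; apply: ler_sum => i _.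
rewrite normrM normrX ler_wpM2l// lerXn2r ?nnegrE ?addr_ge0//.
have := ler_norm b; have := ler_norm (- a); rewrite normrN.
by have := normr_ge0 a; have := normr_ge0 b; rewrite ler_norml; lra.
Qed.

Lemma horner_integrable (m : {finite_measure set (measurableTypeR R) -> \bar R})
    (p : {poly R}) (a b : R) : m.-integrable `[a, b] (fun x => (p.[x])%:E).
Proof.
have [M pM] := horner_bounded p a b.
exact: (bounded_integrable _ _ _ M _ (horner_measurable p) pM).
Qed.

Lemma integral_horner (m1 m2 : {finite_measure set (measurableTypeR R) -> \bar R}) (a b : R) :
    (forall n, \int[m1]_(x in `[a, b]) (x ^+ n)%:E =
               \int[m2]_(x in `[a, b]) (x ^+ n)%:E)%E ->
  forall p : {poly R}, (\int[m1]_(x in `[a, b]) (p.[x])%:E =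
                        \int[m2]_(x in `[a, b]) (p.[x])%:E)%E.
Proof.
move=> m12 p.
have E (m : {finite_measure set (measurableTypeR R) -> \bar R}) :
    (\int[m]_(x in `[a, b]) (p.[x])%:E =
     \sum_(i < size p) (p`_i)%:E * \int[m]_(x in `[a, b]) (x ^+ i)%:E)%E.
  under eq_integral do rewrite horner_coef -sumEFin.
  have I (q : {poly R}) := horner_integrable m q a b.
  rewrite integral_sum//; last first.
    move=> i; rewrite (_ : (fun _ => _) = fun x => ((p`_i *: 'X^i).[x])%:E)//.
    by apply/funext => x; rewrite !hornerE.
  apply: eq_bigr => i _; rewrite -integralZl//.
  rewrite (_ : (fun _ => _) = fun x => (('X^i).[x])%:E)//.
  by apply/funext => x; rewrite !hornerE.
by rewrite !E; apply: eq_bigr => i _; rewrite m12.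
Qed.

(** Open left half-lines form a pi-system generating the Borel sets and exhaust the line. *)
Lemma halfline_unique (m1 m2 : {finite_measure set (measurableTypeR R) -> \bar R}) :
    (forall x, m1 `]-oo, x[%classic = m2 `]-oo, x[%classic) ->
  forall B : set (measurableTypeR R), measurable B -> m1 B = m2 B.
Proof.
move=> m12 B mB.
apply: (@measure_unique _ R (measurableTypeR R) (@RGenInftyO.G R)
  (fun n => `]-oo, n%:R[%classic) _ _ _ _ m1 m2) => //.
- exact: RGenInftyO.measurableE.
- move=> _ _ [x ->] [y ->]; exists (Num.min x y); apply/seteqP; split => z /=.
    by rewrite !in_itv/= lt_min => -[-> ->].
  by rewrite !in_itv/= lt_min => /andP[].
- by move=> n; exists n%:R.
- apply/seteqP; split => // x _; exists (Num.truncn `|x|).+1 => //=.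
  by rewrite in_itv/= (le_lt_trans (ler_norm x))// truncnS_gt.
- by move=> _ [x ->]; exact: m12.
- by move=> n; rewrite ltey_eq fin_num_measure.
Qed.

(** After rescaling [[a, b]] to [[0, 1]], the explicit polynomials [p n] stay between 0 and 1 and
    converge pointwise to the indicator of a half-line. By dominated convergence, the mass of the
    half-line is a limit of integrals of polynomials, which the moments determine. *)
Lemma moments_unique (m1 m2 : {finite_measure set (measurableTypeR R) -> \bar R}) (a b : R) :
    a < b -> m1 (~` `[a, b]%classic) = 0%E -> m2 (~` `[a, b]%classic) = 0%E ->
    (forall n, \int[m1]_(x in `[a, b]) (x ^+ n)%:E =
               \int[m2]_(x in `[a, b]) (x ^+ n)%:E)%E ->
  forall B : set (measurableTypeR R), measurable B -> m1 B = m2 B.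
Proof.
move=> ab m1ab m2ab m12; apply: halfline_unique => z.
have ba0 : 0 < b - a by rewrite subr_gt0.
pose I : set (measurableTypeR R) := `[a, b]%classic; have mI : measurable I by exact: measurable_itv.
pose H : set (measurableTypeR R) := `]-oo, z[%classic; have mH : measurable H by exact: measurable_itv.
have trace (m : {finite_measure set (measurableTypeR R) -> \bar R}) :
    m (~` I) = 0%E -> m H = m (I `&` H).
  move=> mI0; rewrite -[X in m X]setIT -(setUv I) setIUr measureU//; last 3 first.
  - exact: measurableI.
  - by apply: measurableI => //; exact: measurableC.
  - by rewrite setIACA setICr setI0.
  rewrite [X in (_ + X)%E](_ : _ = 0%E) ?adde0 1?setIC//.
  apply: (subset_measure0 (B := ~` I)) => //.
  - by apply: measurableI => //; exact: measurableC.
  - exact: measurableC.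
rewrite -/H !trace//.
have [za|az] := leP z a.
  rewrite (_ : I `&` H = set0) ?measure0//; apply/seteqP; split => // x [].
  rewrite /I /H/= !in_itv/= => /andP[ax _] xz.
  by have := lt_le_trans xz za; rewrite ltNge ax.
(* Here the half-line contains the whole interval, and the moment of order 0 is the total mass. *)
have [bz|zb] := ltP b z.
  rewrite (_ : I `&` H = I); last first.
    apply: setIidl => x; rewrite /I /H/= !in_itv/= => /andP[_ xb].
    exact: le_lt_trans bz.
  have := m12 0%N; under eq_integral do rewrite expr0.
  under [in RHS]eq_integral do rewrite expr0.
  by rewrite !integral_cst// !mul1e.
(* The cut [z] in the rescaled variable; [a < z <= b] places it in []0, 1]], as the step polynomials
   require. *)
pose s := (z - a) / (b - a).
have s01 : 0 < s <= 1.
  by rewrite divr_gt0 ?subr_gt0//= ler_pdivrMr// mul1r lerD2r.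
pose p n : {poly R} := (1 - ((b - a)^-1 *: ('X - a%:P)) ^+ n) ^+ step_degree s n.
have pE n x : (p n).[x] = (1 - ((x - a) / (b - a)) ^+ n) ^+ step_degree s n.
  by rewrite /p !hornerE mulrC.
have lim (m : {finite_measure set (measurableTypeR R) -> \bar R}) :
    (\int[m]_(x in I) ((p n).[x])%:E @[n --> \oo] --> m (I `&` H))%E.
  have [] := @dominated_convergence _ _ _ m I mI
    (fun n x => ((p n).[x])%:E) (fun x => (\1_H x)%:E) (cst 1%E).
  - move=> n; apply/measurable_EFinP/measurable_funTS. exact: horner_measurable.
  - by apply/measurable_EFinP/measurable_indic.
  - apply: aeW => x /=; rewrite /I/= in_itv/= => /andP[ax xb].
    apply: cvg_EFin; first exact: nearW.
    rewrite /comp/=; under eq_fun do rewrite pE.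
    rewrite indicE; have [xz|zx] := ltP x z.
      rewrite mem_set/=; last by rewrite /H/= in_itv.
      apply: cvg_step_left => //.
      by rewrite divr_ge0 ?subr_ge0 ?(ltW ab)//= ltr_pM2r ?invr_gt0// ltrD2r.
    rewrite memNset/=; last by rewrite /H/= in_itv/= => /(le_lt_trans zx); rewrite ltxx.
    apply: cvg_step_right => //.
    by rewrite ler_pM2r ?invr_gt0// lerD2r zx/= ler_pdivrMr// mul1r lerD2r.
  - by apply: (bounded_integrable m I (cst 1) 1) => // x _ /=; rewrite normr1.
  - apply: aeW => x n /=; rewrite /I/= in_itv/= => /andP[ax xb].
    have y01 : 0 <= ((x - a) / (b - a)) ^+ n <= 1.
      have ? : 0 <= (x - a) / (b - a) by rewrite divr_ge0 ?subr_ge0 ?(ltW ab).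
      by rewrite exprn_ge0//= exprn_ile1// ler_pdivrMr// mul1r lerD2r.
    case/andP: y01 => y0 y1.
    by rewrite lee_fin pE ger0_norm ?exprn_ge0 ?subr_ge0// exprn_ile1 ?subr_ge0// gerBl.
  by move=> _ _; rewrite integral_indic// setIC.
have := lim m2; under eq_fun do rewrite -(integral_horner _ _ _ _ m12).
exact/cvg_unique/lim.
Qed.

End moment_determinacy.

(** * The map c *)

Section change_of_variables.
Variable R : realType.

(* The law of [c_i] under the measure [w_i mu_i] on [D_i] is determined by its
   moments. *)
Lemma weighted_pushforward_unique d1 d2 (T1 : measurableType d1)
    (T2 : measurableType d2)
    (mu1 : {sigma_finite_measure set T1 -> \bar R})
    (mu2 : {sigma_finite_measure set T2 -> \bar R})
    (D1 : set T1) (D2 : set T2) (w1 c1 : T1 -> R) (w2 c2 : T2 -> R) :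
    measurable D1 -> (mu1 D1 < +oo)%E -> measurable_fun [set: T1] w1 ->
    measurable_fun [set: T1] c1 -> (forall t, D1 t -> 0 <= w1 t <= 1) ->
    (forall t, D1 t -> 0 <= c1 t <= 1) ->
    measurable D2 -> (mu2 D2 < +oo)%E -> measurable_fun [set: T2] w2 ->
    measurable_fun [set: T2] c2 -> (forall t, D2 t -> 0 <= w2 t <= 1) ->
    (forall t, D2 t -> 0 <= c2 t <= 1) ->
    (forall n, \int[mu1]_(t in D1) (c1 t ^+ n * w1 t)%:E =
               \int[mu2]_(t in D2) (c2 t ^+ n * w2 t)%:E)%E ->
  forall (E : set (measurableTypeR R)) (f : R -> \bar R), measurable E ->
    measurable_fun [set: R] f -> (forall x, E x -> (0 <= f x)%E) ->
    (\int[mu1]_(t in D1 `&` c1 @^-1` E) (f (c1 t) * (w1 t)%:E) =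
     \int[mu2]_(t in D2 `&` c2 @^-1` E) (f (c2 t) * (w2 t)%:E))%E.
Proof.
move=> mD1 fD1 mw1 mc1 w1b c1b mD2 fD2 mw2 mc2 w2b c2b mom E f mE mf f0.
have [m1 hm1] := exists_pushforward_density _ _ _ mu1 D1 w1 c1 mD1 fD1 mw1 mc1 w1b.
have [m2 hm2] := exists_pushforward_density _ _ _ mu2 D2 w2 c2 mD2 fD2 mw2 mc2 w2b.
rewrite -hm1// -hm2//; apply: eq_measure_integral => B mB _.
have mI : measurable (`[0, 1]%classic : set (measurableTypeR R)).
  exact: measurable_itv.
have out d (T : measurableType d) (mu : {sigma_finite_measure set T -> \bar R})
    (D : set T) (w c : T -> R) (m : {finite_measure set (measurableTypeR R) -> \bar R}) :
    (forall t, D t -> 0 <= c t <= 1) ->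
    (forall (E : set (measurableTypeR R)) (f : R -> \bar R), measurable E ->
      measurable_fun [set: R] f -> (forall x, E x -> (0 <= f x)%E) ->
      (\int[m]_(x in E) f x =
       \int[mu]_(t in D `&` c @^-1` E) (f (c t) * (w t)%:E))%E) ->
    m (~` `[0, 1]%classic) = 0%E.
  move=> cb hm; have := hm (~` `[0, 1]%classic) (cst 1%E) (measurableC mI).
  rewrite integral_cst ?mul1e; last exact: measurableC.
  move=> ->//; rewrite (_ : _ `&` _ = set0) ?integral_set0//.
  by apply/seteqP; split => // t [/cb cb']; apply; rewrite /= in_itv.
apply: (moments_unique _ m1 m2 0 1) => //.
- exact: (out _ _ _ _ _ _ _ c1b hm1).
- exact: (out _ _ _ _ _ _ _ c2b hm2).
move=> n; have mXn : measurable_fun [set: R] (fun x : R => (x ^+ n)%:E).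
  by apply/measurable_EFinP; apply: measurable_funX.
rewrite (hm1 _ (fun x => (x ^+ n)%:E))// 2?(hm2 _ (fun x => (x ^+ n)%:E))//; last 2 first.
- by move=> x /=; rewrite in_itv/= => /andP[x0 _]; rewrite lee_fin exprn_ge0.
- by move=> x /=; rewrite in_itv/= => /andP[x0 _]; rewrite lee_fin exprn_ge0.
rewrite !setIidl; last 2 first.
- by move=> t /c2b; rewrite /= in_itv.
- by move=> t /c1b; rewrite /= in_itv.
exact: mom.
Qed.

Lemma FTC2_everywhere (F f : R -> R) (a b : R) : a < b ->
  (forall x, is_derive x (1 : R) F (f x)) -> continuous f ->
  (\int[lebesgue_measure]_(x in `[a, b]) (f x)%:E = (F b - F a)%:E)%E.
Proof.
move=> ab dF cf; have cF x : {for x, continuous F}.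
  by apply/differentiable_continuous/derivable1_diffP; have [] := dF x.
rewrite (continuous_FTC2 (F := F))//.
- exact: continuous_subspaceT.
- split => [x _||].
  + by have [] := dF x.
  + exact: cvg_at_right_filter (cF a).
  + exact: cvg_at_left_filter (cF b).
- by move=> x _; rewrite derive1E; have [_ ->] := dF x.
Qed.

(** The map [c], that is [cos^2 (t / 2)]. *)
Definition half_cos (t : R) : R := (1 + cos t) / 2.

Lemma is_derive_half_cos (x : R) : is_derive x (1 : R) half_cos (- sin x / 2).
Proof.
rewrite (_ : half_cos = 2^-1 \*: (cst 1 + cos)); last first.
  by apply/funext => t; rewrite /half_cos mulrC.
apply: is_derive_eq; rewrite add0r mulrC.
by [].
Qed.

Lemma continuous_half_cos : continuous half_cos.
Proof.
move=> x; apply/differentiable_continuous/derivable1_diffP.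
by have [] := is_derive_half_cos x.
Qed.

Lemma half_cos_bound (t : R) : 0 <= half_cos t <= 1.
Proof.
rewrite /half_cos; have := cos_geN1 t; have := cos_le1 t; lra.
Qed.

(** This makes [|sin t| / 2] a function of [half_cos t] and is the source of the factor
    [Num.sqrt (x * (1 - x))] in the density. *)
Lemma half_cos_onem (t : R) : half_cos t * (1 - half_cos t) = (sin t / 2) ^+ 2.
Proof. by rewrite expr_div_n sin2cos2 /half_cos; field. Qed.

(** As [sin t / 2] is minus the derivative of [half_cos], both integrands have explicit primitives
    and both sides equal [1 / (n + 1)]. The factor [1] on the right is the weight expected by
    [weighted_pushforward_unique]. *)
Lemma integral_half_cos_sin (n : nat) :
  (\int[lebesgue_measure]_(t in `]0%R, (pi : R)[) (half_cos t ^+ n * (sin t / 2))%:E =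
   \int[lebesgue_measure]_(x in `[0%R, 1%R : R]) (x ^+ n * 1)%:E)%E.
Proof.
pose F (t : R) : R := - (n.+1%:R^-1 * half_cos t ^+ n.+1).
pose G (x : R) : R := n.+1%:R^-1 * x ^+ n.+1.
have mf : continuous (fun t : R => half_cos t ^+ n * (sin t / 2)).
  move=> x; apply: cvgM; last by apply: cvgMl; exact: continuous_sin.
  exact: (continuous_comp (continuous_half_cos x) (@exprn_continuous R n _)).
(* Adding the two endpoints, which are null, gives the closed interval on which the fundamental
   theorem is applied. *)
rewrite -(@integral_itv_bndoo _ _ _ _ true false); last first.
  by apply/measurable_EFinP/measurable_funTS; exact: continuous_measurable_fun.
have dF x : is_derive x (1 : R) F (half_cos x ^+ n * (sin x / 2)).
  have d := is_derive_half_cos x.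
  have dX : is_derive x (1 : R) (half_cos ^+ n.+1)
      ((n.+1%:R * half_cos x ^+ n) *: (- sin x / 2)) by exact: is_deriveX.
  rewrite (_ : F = - (n.+1%:R^-1 \*: (half_cos ^+ n.+1))); last first.
    by apply/funext => t; rewrite /F fctE /= exprfctE.
  apply: is_derive_eq; rewrite /GRing.scale/=; field.
  by rewrite addrC natr1 pnatr_eq0.
have dG x : is_derive x (1 : R) G (x ^+ n * 1).
  rewrite (_ : G = n.+1%:R^-1 \*: (id ^+ n.+1)); last first.
    by apply/funext => t; rewrite /G /= exprfctE.
  apply: is_derive_eq; rewrite /GRing.scale/=; field.
  by rewrite addrC natr1 pnatr_eq0.
rewrite (FTC2_everywhere _ _ _ _ (pi_gt0 R) dF mf).
rewrite (FTC2_everywhere _ _ _ _ ltr01 dG); last first.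
  by move=> x; apply: cvgMl; exact: exprn_continuous.
rewrite /F /G /half_cos cospi cos0; congr EFin.
have -> : (1 - 1) / 2 = 0 :> R by lra.
have -> : (1 + 1) / 2 = 1 :> R by lra.
by rewrite !expr0n/= !expr1n !mulr0 oppr0 add0r opprK ?subr0 ?addr0.
Qed.

Lemma measurable_half_cos : measurable_fun [set: R] half_cos.
Proof. by apply: continuous_measurable_fun; exact: continuous_half_cos. Qed.

Lemma measurable_half_sin : measurable_fun [set: R] (fun t : R => sin t / 2).
Proof.
apply: continuous_measurable_fun => t.
by apply: cvgMl; exact: continuous_sin.
Qed.

Lemma half_sin_bound (t : R) : `]0%R, (pi : R)[%classic t -> 0 < sin t / 2 <= 1.
Proof.
rewrite /= in_itv/= => /sin_gt0_pi s0; rewrite divr_gt0//=.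
by have := sin_le1 t; lra.
Qed.

(** The image of [(sin t / 2) dt] by [half_cos] and Lebesgue measure on [[0, 1]] have the same
    moments, hence coincide; this gives the substitution for every measurable nonnegative [f]. *)
Lemma ge0_half_cos_substitution (E : set (measurableTypeR R)) (f : R -> \bar R) :
    measurable E -> measurable_fun [set: R] f -> (forall x, E x -> (0 <= f x)%E) ->
  (\int[lebesgue_measure]_(t in `]0%R, (pi : R)[ `&` half_cos @^-1` E)
     (f (half_cos t) * (sin t / 2)%:E) =
   \int[lebesgue_measure]_(x in `[0%R, 1%R] `&` E) f x)%E.
Proof.
move=> mE mf f0.
have fin b0 b1 (u v : R) : (lebesgue_measure [set` Interval (BSide b0 u) (BSide b1 v)] < +oo)%E.
  by rewrite lebesgue_measure_itv; case: ifP => _; rewrite ltry.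
rewrite (@weighted_pushforward_unique _ _ _ _ lebesgue_measure lebesgue_measure
  `]0%R, (pi : R)[%classic `[0%R, 1%R]%classic
  (fun t => sin t / 2) half_cos (cst 1) id)//.
- by apply: eq_integral => x _; rewrite mule1.
- exact: fin.
- exact: measurable_half_sin.
- exact: measurable_half_cos.
- by move=> t /half_sin_bound /andP[/ltW -> ->].
- by move=> t _; exact: half_cos_bound.
- exact: fin.
- by move=> t _; rewrite ler01 lexx.
- exact: integral_half_cos_sin.
Qed.

(** The positive weight [sin t / 2] factors out of the positive and the negative part, and each part
    falls under the nonnegative case. *)
Lemma half_cos_substitution (E : set (measurableTypeR R)) (f : R -> R) :
    measurable E -> measurable_fun [set: R] f ->
  (\int[lebesgue_measure]_(t in `]0%R, (pi : R)[ `&` half_cos @^-1` E)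
     (f (half_cos t) * (sin t / 2))%:E =
   \int[lebesgue_measure]_(x in `[0%R, 1%R] `&` E) (f x)%:E)%E.
Proof.
move=> mE mf; have mEf : measurable_fun [set: R] (EFin \o f) by exact/measurable_EFinP.
rewrite [LHS]integralE [RHS]integralE; congr (_ - _)%E.
  rewrite -(ge0_half_cos_substitution E (EFin \o f)^\+%E)//; last exact: measurable_funepos.
  apply: eq_integral => t; rewrite inE => -[/half_sin_bound /andP[s0 _] _].
  by rewrite !funeposE/= -!EFin_max -EFinM maxr_pMl ?ltW// mul0r.
rewrite -(ge0_half_cos_substitution E (EFin \o f)^\-%E)//; last exact: measurable_funeneg.
apply: eq_integral => t; rewrite inE => -[/half_sin_bound /andP[s0 _] _].
by rewrite !funenegE/= -!EFin_max -EFinM maxr_pMl ?ltW// mul0r mulNr.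
Qed.

Lemma measurable_arcsine :
  measurable_fun [set: R] (fun x : R => (Num.sqrt (x * (1 - x)))^-1).
Proof.
(* On nonnegative reals, including 0 where the inverse is 0 by convention, inversion is the power
   with exponent -1, which is known to be measurable. *)
rewrite (_ : (fun _ => _) = (@powR R)^~ (-1) \o (fun x : R => Num.sqrt (x * (1 - x)))).
  apply: measurableT_comp; first exact: measurable_powR.
  apply: (measurableT_comp (f := @Num.sqrt R)).
    by apply: continuous_measurable_fun; exact: sqrt_continuous.
  by apply: measurable_funM => //; exact: measurable_funB.
by apply/funext => x; rewrite /= powR_inv1// sqrtr_ge0.
Qed.

(** The hypothesis identifies the images of the two halves of the circle weighted by [|sin t| / 2].
    This weight is a nonvanishing function of [half_cos t] there, so integrating its inverse [f]
    removes it. *)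
Lemma half_cos_symmetric (nu : {finite_measure set (measurableTypeR R) -> \bar R}) :
    (forall n, \int[nu]_(t in `]0%R, (pi : R)[) (half_cos t ^+ n * (sin t / 2))%:E =
      \int[nu]_(t in `](- pi)%R, 0%R : R[) (half_cos t ^+ n * - (sin t / 2))%:E)%E ->
  forall E : set (measurableTypeR R), measurable E ->
    nu (`]0%R, pi[ `&` half_cos @^-1` E) = nu (`]- pi, 0%R[ `&` half_cos @^-1` E).
Proof.
move=> mom E mE.
pose f (x : R) : \bar R := ((Num.sqrt (x * (1 - x)))^-1)%:E.
have mf : measurable_fun [set: R] f.
  by apply/measurable_EFinP; exact: measurable_arcsine.
have fs (t : R) : sin t != 0 -> (f (half_cos t) * `|sin t / 2|%:E = 1)%E.
  move=> s0; rewrite /f half_cos_onem sqrtr_sqr -EFinM mulVf//.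
  by rewrite normr_eq0 mulf_neq0// invr_eq0 pnatr_eq0.
have mD a b : measurable (`]a, b[%classic `&` half_cos @^-1` E : set (measurableTypeR R)).
  apply: measurableI; first exact: measurable_itv.
  by rewrite -[X in measurable X]setTI; exact: measurable_half_cos.
have fin (A : set (measurableTypeR R)) : measurable A -> (nu A < +oo)%E.
  by move=> mA; rewrite ltey_eq fin_num_measure.
have sN (t : R) : `](- pi)%R, 0%R : R[%classic t -> 0 < - (sin t / 2) <= 1.
  move=> t0; rewrite -mulNr -sinN; apply: half_sin_bound.
  by move: t0; rewrite /= !in_itv/= oppr_gt0 ltrNl => /andP[-> ->].
have mI a b : measurable (`]a, b[%classic : set (measurableTypeR R)).
  exact: measurable_itv.
have f0 x : E x -> (0 <= f x)%E by rewrite lee_fin invr_ge0 sqrtr_ge0.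
have mNs : measurable_fun [set: R] (fun t : R => - (sin t / 2)).
  exact: measurableT_comp measurable_half_sin.
have E1 : (nu (`]0%R, pi[ `&` half_cos @^-1` E) =
    \int[nu]_(t in `]0%R, (pi : R)[ `&` half_cos @^-1` E)
      (f (half_cos t) * (sin t / 2)%:E))%E.
  rewrite -[LHS]mul1e -integral_cst//; apply: eq_integral => t.
  rewrite inE => -[/half_sin_bound/andP[t0 _] _].
  rewrite -(ger0_norm (ltW t0)) fs//.
  by apply: contraTneq t0 => ->; rewrite mul0r ltxx.
have E2 : (nu (`](- pi)%R, 0%R[ `&` half_cos @^-1` E) =
    \int[nu]_(t in `](- pi)%R, 0%R : R[ `&` half_cos @^-1` E)
      (f (half_cos t) * (- (sin t / 2))%:E))%E.
  rewrite -[LHS]mul1e -integral_cst//; apply: eq_integral => t.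
  rewrite inE => -[/sN/andP[t0 _] _].
  rewrite -(ger0_norm (ltW t0)) normrN fs//.
  by apply: contraTneq t0 => ->; rewrite mul0r oppr0 ltxx.
rewrite E1 E2; apply: weighted_pushforward_unique => //.
- exact: fin.
- exact: measurable_half_sin.
- exact: measurable_half_cos.
- by move=> t /half_sin_bound /andP[/ltW -> ->].
- by move=> t _; exact: half_cos_bound.
- exact: fin.
- exact: measurable_half_cos.
- by move=> t /sN /andP[/ltW -> ->].
- by move=> t _; exact: half_cos_bound.
Qed.

(** The half angle lies in []0, pi / 2[], where the cosine is positive and is inverted by [acos]. *)
Lemma half_cosK (t : R) : `]0%R, (pi : R)[%classic t ->
  2 * acos (Num.sqrt (half_cos t)) = t.
Proof.
rewrite /= in_itv/= => /andP[t0 tpi].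
have -> : half_cos t = cos (t / 2) ^+ 2.
  have := cos_mulr2n (t / 2); rewrite -[t / 2 *+ 2]mulr_natr divfK// /half_cos => ->.
  by rewrite -[_ *+ 2]mulr_natr addrC subrK mulfK.
rewrite sqrtr_sqr ger0_norm; last by rewrite ltW// cos_gt0_pihalf//; lra.
rewrite cosK; first by field.
by rewrite in_itv/=; apply/andP; split; lra.
Qed.

Lemma measurable_acos_sqrt :
  measurable_fun (`]0%R, 1%R[%classic : set R) (fun x : R => 2 * acos (Num.sqrt x)).
Proof.
apply: open_continuous_measurable_fun; first exact: interval_open.
move=> x; rewrite inE/= in_itv/= => /andP[x0 x1].
apply: cvgMr; apply: (@continuous_comp _ _ _ (@Num.sqrt R) (@acos R)).
  exact: sqrt_continuous.
apply: continuous_acos; rewrite (lt_le_trans _ (sqrtr_ge0 x)) ?ltrN10//=.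
by rewrite -sqrtr1 ltr_sqrt.
Qed.

(** Substitute [x = half_cos t]: then [2 * acos (Num.sqrt x)] is [t], and the Jacobian [sin t / 2]
    cancels [Num.sqrt (x * (1 - x))]. *)
Lemma arcsine_integral (kappa : R -> R) (B : set (measurableTypeR R)) :
    measurable B ->
    (@lebesgue_measure R).-integrable (circle R) (EFin \o kappa) ->
  (\int[lebesgue_measure]_(x in B)
     (kappa (2 * acos (Num.sqrt x)) / (2 * pi * Num.sqrt (x * (1 - x))) *
      \1_(`[0%R, 1%R] : set R) x)%:E =
   ((2 * pi)^-1)%:E *
     \int[lebesgue_measure]_(t in `]0%R, (pi : R)[ `&` half_cos @^-1` B) (kappa t)%:E)%E.
Proof.
move=> mB ik.
pose D : set R := `]0%R, (pi : R)[%classic.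
have DC : D `<=` circle R.
  move=> t; rewrite /D/= /circle/= !in_itv/= => /andP[t0 /ltW ->].
  by rewrite (lt_trans _ t0)// oppr_lt0 pi_gt0.
(* [kappa] is measurable on the circle only; cutting it, and then [acos], off outside open intervals
   yields functions measurable on the whole line. *)
pose h : R -> R := kappa \_ D.
have mh : measurable_fun [set: R] h.
  apply/(measurable_restrictT _ (measurable_itv _)).
  apply: (measurable_funS (E := circle R)); [exact: measurable_itv|exact: DC|].
  by apply/measurable_EFinP; exact: measurable_int ik.
pose psi := (fun x : R => 2 * acos (Num.sqrt x)) \_ (`]0%R, 1%R[%classic : set R).
have mpsi : measurable_fun [set: R] psi.
  by apply/(measurable_restrictT _ (measurable_itv _)); exact: measurable_acos_sqrt.
pose g (x : R) := h (psi x) * (2 * pi)^-1 * (Num.sqrt (x * (1 - x)))^-1.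
have mg : measurable_fun [set: R] g.
  apply: measurable_funM measurable_arcsine; apply: measurable_funM => //.
  exact: measurableT_comp.
(* The cut-offs change nothing: at the endpoints 0 and 1 the square root vanishes, and so does its
   inverse by convention. *)
have gE x : kappa (2 * acos (Num.sqrt x)) / (2 * pi * Num.sqrt (x * (1 - x))) *
      \1_(`[0%R, 1%R] : set R) x = (g \_ (`[0%R, 1%R]%classic : set R)) x.
  rewrite patchE indicE; case: ifPn => [|_]; last by rewrite mulr0.
  rewrite inE/= in_itv/= => /andP[x0 x1]; rewrite mulr1 /g invfM mulrA.
  move: x0; rewrite le_eqVlt => /predU1P[<-|x0].
    by rewrite mul0r sqrtr0 invr0 !mulr0.
  move: x1; rewrite le_eqVlt => /predU1P[->|x1].
    by rewrite subrr mulr0 sqrtr0 invr0 !mulr0.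
  congr (_ / _ / _); rewrite /psi patchE mem_set/=; last by rewrite in_itv/= x0.
  rewrite /h patchE mem_set// /D/= in_itv/=.
  have s0 : 0 < Num.sqrt x by rewrite sqrtr_gt0.
  have s1 : Num.sqrt x < 1 by rewrite -sqrtr1 ltr_sqrt.
  rewrite mulr_gt0 ?acos_gt0//=; last by rewrite s1 andbT; lra.
  rewrite mulrC -ltr_pdivlMr// -(ltr_cos (R := R)) ?in_itv/=.
  - by rewrite cos_pihalf acosK// in_itv/=; lra.
  - by rewrite acos_ge0 ?acos_lepi//; lra.
  - by have := pi_gt0 R; lra.
under eq_integral do rewrite gE.
transitivity (\int[lebesgue_measure]_(x in `[0%R, 1%R] `&` B) (g x)%:E)%E.
  rewrite [RHS]integral_mkcond [LHS]integral_mkcond; apply: eq_integral => x _.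
  rewrite !patchE in_setI; case: (x \in B); case: (x \in `[0%R, 1%R]%classic) => //.
have mDB : measurable (D `&` half_cos @^-1` B : set (measurableTypeR R)).
  apply: measurableI; first exact: measurable_itv.
  by rewrite -[X in measurable X]setTI; exact: measurable_half_cos.
rewrite -half_cos_substitution// -integralZl//; last first.
  apply: integrableS ik => //; first exact: measurable_itv.
  by move=> t [/DC].
apply: eq_integral => t; rewrite inE => -[Dt _].
have s0 : 0 < sin t / 2 by case/half_sin_bound/andP: Dt.
have c01 : 0 < half_cos t < 1.
  have : 0 < half_cos t * (1 - half_cos t) by rewrite half_cos_onem exprn_gt0.
  by have /andP[c0 c1] := half_cos_bound t; nra.
rewrite -EFinM /g half_cos_onem sqrtr_sqr ger0_norm ?ltW//.
rewrite mulfVK ?gt_eqF// mulrC /psi patchE mem_set/=; last by rewrite in_itv.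
by rewrite half_cosK// /h patchE mem_set.
Qed.

End change_of_variables.

(** * The law of the compression *)

Section fourier.
Variables (R : realType) (A : wstarProbabilitySpace R).
Local Open Scope complex_scope.
Local Notation tau := (@wps_state R A).

Lemma unitary_expS (x : A) (k : int) : Defs.is_unitary x ->
  x * unitary_exp x k = unitary_exp x (k + 1) /\
  vn_star x * unitary_exp x k = unitary_exp x (k - 1).
Proof.
have nS n : Negz n.+1 = Negz n - 1 by rewrite !NegzE -opprD addrC -intS.
move=> [sx xs]; case: k => [n|n].
  split; first by rewrite addrC -intS /= exprS.
  case: n => [|n]; first by rewrite mulr1 sub0r.
  by rewrite intS addrAC subrr add0r -intS /= exprS mulrA sx mul1r.
split; last by rewrite -nS /= -exprS.
case: n => [|n]; first by rewrite /= expr1 xs.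
by rewrite nS subrK -nS /= exprS mulrA xs mul1r.
Qed.

(** Functional calculus for trigonometric polynomials, by induction on [n]. Multiplying by
    [(2 + x + x^-1) / 4] shifts the power of [x] by 0, 1 and -1, which matches the addition formulas
    for [half_cos t * cos (k t)] and [half_cos t * sin (k t)]. All [k] are treated at once because
    of these shifts. *)
Lemma state_cos2_half_exp (x : A) (nu : probability (measurableTypeR R) R) :
    Defs.is_unitary x -> unitary_spectral_distribution x nu ->
  forall (n : nat) (k : int),
  (\int[nu]_(t in circle R) (half_cos R t ^+ n * cos (k%:~R * t)))%R +i*
  (\int[nu]_(t in circle R) (half_cos R t ^+ n * sin (k%:~R * t)))%R =
  tau ((4^-1 *: (2%:R + x + vn_star x)) ^+ n * unitary_exp x k).
Proof.
move=> ux [_ hnu]; set T := 4^-1 *: _; elim=> [|n IH] k.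
  rewrite expr0 mul1r -hnu /circle_moment.
  by congr (_ +i* _); apply: eq_Rintegral => t _; rewrite expr0 mul1r.
have [xk sk] := unitary_expS x k ux.
have mcos (r : R) : measurable_fun [set: R] (fun t : R => cos (r * t)).
  by apply: continuous_measurable_fun => t; apply: continuous_comp;
    [exact: mulrl_continuous|exact: continuous_cos].
have msin (r : R) : measurable_fun [set: R] (fun t : R => sin (r * t)).
  by apply: continuous_measurable_fun => t; apply: continuous_comp;
    [exact: mulrl_continuous|exact: continuous_sin].
have mC : measurable (circle R : set (measurableTypeR R)) by exact: measurable_itv.
have cb m (t : R) : `|half_cos R t ^+ m| <= 1.
  have /andP[c0 c1] := half_cos_bound R t.
  by rewrite ger0_norm ?exprn_ge0// exprn_ile1.
have ic m j : nu.-integrable (circle R) (EFin \o (fun t => half_cos R t ^+ m * cos (j%:~R * t))).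
  apply: (bounded_integrable R nu (circle R) _ 1) => //.
    apply: measurable_funM => //; apply: measurable_funX; exact: measurable_half_cos.
  by move=> t _; rewrite normrM mulr_ile1// ler_norml cos_geN1 cos_le1.
have isn m j : nu.-integrable (circle R) (EFin \o (fun t => half_cos R t ^+ m * sin (j%:~R * t))).
  apply: (bounded_integrable R nu (circle R) _ 1) => //.
    apply: measurable_funM => //; apply: measurable_funX; exact: measurable_half_cos.
  by move=> t _; rewrite normrM mulr_ile1// ler_norml sin_geN1 sin_le1.
(* The term [f0] occurs twice to mirror the constant [2 = 1 + 1] in [T]. *)
have step (f f0 f1 f2 : R -> R) :
    nu.-integrable (circle R) (EFin \o f0) ->
    nu.-integrable (circle R) (EFin \o f1) ->
    nu.-integrable (circle R) (EFin \o f2) ->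
    (forall t, f t = 4^-1 * (f0 t + f0 t + f1 t + f2 t)) ->
    \int[nu]_(t in circle R) f t = 4^-1 * (\int[nu]_(t in circle R) f0 t +
      \int[nu]_(t in circle R) f0 t + \int[nu]_(t in circle R) f1 t +
      \int[nu]_(t in circle R) f2 t).
  move=> i0 i1 i2 fE; under eq_Rintegral do rewrite fE.
  have i00 : nu.-integrable (circle R) (EFin \o (fun t => f0 t + f0 t)).
    exact: (integrableD mC i0 i0).
  have i001 : nu.-integrable (circle R) (EFin \o (fun t => f0 t + f0 t + f1 t)).
    exact: (integrableD mC i00 i1).
  rewrite RintegralZl//; last exact: (integrableD mC i001 i2).
  by rewrite RintegralD// RintegralD// RintegralD.
have argD (t : R) : ((k + 1)%:~R * t = k%:~R * t + t) by rewrite intrD mulrDl mul1r.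
have argB (t : R) : ((k - 1)%:~R * t = k%:~R * t - t) by rewrite intrB mulrBl mul1r.
rewrite exprSr -mulrA {2}/T -scalerAl !mulrDl xk sk !mul1r -scalerAr linearZ/=.
rewrite !mulrDr !(raddfD tau)/= -!IH.
have /= -> := step (fun t => half_cos R t ^+ n.+1 * cos (k%:~R * t)) _ _ _
    (ic n k) (ic n (k + 1)) (ic n (k - 1)); last first.
  by move=> t; rewrite argD argB cosB cosD exprS {1}/half_cos; field.
have /= -> := step (fun t => half_cos R t ^+ n.+1 * sin (k%:~R * t)) _ _ _
    (isn n k) (isn n (k + 1)) (isn n (k - 1)); last first.
  by move=> t; rewrite argD argB sinB sinD exprS {1}/half_cos; field.
have -> : 4^-1 = (4^-1)%:C :> R[i].
  by rewrite fmorphV /= rmorphMn.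
by apply/eqP; rewrite eq_complex /= !mul0r subr0 addr0 !eqxx.
Qed.

End fourier.

(** * Traces of projections and moments of the product of two symmetries *)

Section traces.
Variables (R : realType) (A : wstarProbabilitySpace R).
Local Open Scope complex_scope.
Local Notation tau := (@wps_state R A).

(** Positivity of the state applied to [p = p^* p] gives a nonnegative real; applied to the
    projection [1 - p] it gives the upper bound. *)
Lemma state_projection (p : A) : is_projection p ->
  tau p = (real_state p)%:C /\ 0 <= real_state p <= 1.
Proof.
have ge0 (q : A) : is_projection q -> tau q = (real_state q)%:C /\ 0 <= real_state q.
  move=> [sq qq]; have := wps_state_ge0 q; rewrite sq qq /real_state.
  by case: (tau q) => x y; rewrite lecE/= => /andP[/eqP-> ->].
move=> pp; have [pE p0] := ge0 _ pp; split=> //; rewrite p0/=.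
have [_] := ge0 _ (projection_onem _ _ _ pp).
by rewrite /real_state linearB/= wps_state1 raddfB/= subr_ge0.
Qed.

Lemma state_symmetry (p : A) : is_projection p ->
  real_state (symmetry_of p) = 2 * real_state p - 1.
Proof.
move=> pp; have [pE _] := state_projection _ pp.
rewrite {1}/real_state /symmetry_of linearB linearZ/= wps_state1 pE.
by rewrite mulr_natl raddfB raddfMn/= mulr_natl.
Qed.

Lemma symmetry_mul_unitary (p q : A) : is_projection p -> is_projection q ->
  Defs.is_unitary (symmetry_of p * symmetry_of q) /\
  vn_star (symmetry_of p * symmetry_of q) = symmetry_of q * symmetry_of p.
Proof.
move=> pp qp; have sE : vn_star (symmetry_of p * symmetry_of q) = symmetry_of q * symmetry_of p.
  by rewrite vn_starM !symmetry_self_adjoint.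
split=> //; rewrite /Defs.is_unitary sE; split.
  by rewrite -mulrA (mulrA (symmetry_of p)) symmetry_involutive// mul1r symmetry_involutive.
by rewrite -mulrA (mulrA (symmetry_of q)) symmetry_involutive// mul1r symmetry_involutive.
Qed.

(** For projections the last two terms are a unitary and its adjoint, so [state_cos2_half_exp]
    applies to [cos2_half A p q]. *)
Lemma cos2_half_symmetry (p q : A) :
  cos2_half A p q = 4^-1 *: (2%:R + symmetry_of p * symmetry_of q + symmetry_of q * symmetry_of p).
Proof.
have E (x y : A) : symmetry_of x * symmetry_of y = 4 *: (x * y) - 2 *: x - 2 *: y + 1.
  rewrite /symmetry_of mulrBr mulr1 mulrBl mul1r -scalerAl -scalerAr scalerA.
  by rewrite opprB -natrM addrA addrAC [_ - 2 *: y - 2 *: x]addrAC.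
apply: (@scalerI _ _ 4); first by rewrite pnatr_eq0.
have four (x : A) : 4 *: x = 2 *: x + 2 *: x by rewrite -scalerDl -natrD.
rewrite scalerA divff ?pnatr_eq0// scale1r !E /cos2_half !scalerDr !scalerN.
rewrite (four 1) (four p) (four q) [2 *: 1]scaler_nat mulr2n.
move: (4 *: (p * q)) (4 *: (q * p)) (2 *: p) (2 *: q) => x y u v.
by rewrite !opprD !addrA [LHS](ACl (1*2*9*5*7*3*10*8*6*4)).
Qed.

(** The exponents [k = 1] and [k = -1] have the same trace, while their imaginary parts are opposite
    sine moments; these therefore vanish. *)
Lemma spectral_sin_moment (p q : A) (nu : probability (measurableTypeR R) R) :
    is_projection p -> is_projection q ->
    unitary_spectral_distribution (symmetry_of p * symmetry_of q) nu ->
  forall n, (\int[nu]_(t in circle R) (half_cos R t ^+ n * sin t))%R = 0.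
Proof.
move=> pp qp hnu n; have [uV sV] := symmetry_mul_unitary _ _ pp qp.
have F := state_cos2_half_exp _ _ _ _ uV hnu n.
have cT : symmetry_of q * cos2_half A p q ^+ n = cos2_half A p q ^+ n * symmetry_of q.
  apply: commrX; apply: commr_sym; apply: commrB; last exact: commr1.
  rewrite /GRing.comm -scalerAl -scalerAr; congr (_ *: _).
  by rewrite cos2_halfC comm_cos2_half//; case: qp.
(* Rotate the symmetry of [q] to the front by traciality, then commute it past the power of
   [cos2_half A p q]. *)
have E : tau (cos2_half A p q ^+ n * unitary_exp (symmetry_of p * symmetry_of q) 1) =
         tau (cos2_half A p q ^+ n * unitary_exp (symmetry_of p * symmetry_of q) (- 1)).
  rewrite /= !expr1 sV mulrA wps_state_tracial (mulrA (symmetry_of q)) cT.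
  by rewrite mulrA.
move: E; rewrite cos2_half_symmetry -sV -!F => /(congr1 (@complex.Im R)) /=.
under eq_Rintegral do rewrite mul1r.
under [in RHS]eq_Rintegral do rewrite mulN1r sinN mulrN -mulN1r.
rewrite RintegralZl//; first lra; first exact: measurable_itv.
apply: (bounded_integrable _ _ _ _ 1); first exact: measurable_itv.
  by apply: measurable_funM; [apply: measurable_funX; exact: measurable_half_cos|
    apply: continuous_measurable_fun; exact: continuous_sin].
move=> t _; have /andP[c0 c1] := half_cos_bound R t.
rewrite normrM mulr_ile1//; last by rewrite ler_norml sin_geN1 sin_le1.
by rewrite ger0_norm ?exprn_ge0// exprn_ile1.
Qed.

Lemma state_cos2_half (p q : A) (nu : probability (measurableTypeR R) R) :
    is_projection p -> is_projection q ->
    unitary_spectral_distribution (symmetry_of p * symmetry_of q) nu ->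
  forall n, tau (cos2_half A p q ^+ n) =
    (\int[nu]_(t in circle R) (half_cos R t ^+ n))%R%:C.
Proof.
move=> pp qp hnu n; have [uV sV] := symmetry_mul_unitary _ _ pp qp.
have := state_cos2_half_exp _ _ _ _ uV hnu n 0.
rewrite /= expr0 mulr1 sV -cos2_half_symmetry => <-.
under eq_Rintegral do rewrite mul0r cos0 mulr1.
under [X in _ +i* X]eq_Rintegral do rewrite mul0r sin0 mulr0.
by rewrite Rintegral_cst ?mul0r//; exact: measurable_itv.
Qed.

Lemma circle_split (nu : probability (measurableTypeR R) R) (f : R -> R) (M : R) :
    measurable_fun [set: R] f -> (forall t, `|f t| <= M) ->
  (\int[nu]_(t in circle R) f t = \int[nu]_(t in `](- pi)%R, 0%R[) f t +
     \int[nu]_(t in `]0%R, (pi : R)[) f t +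
     f 0 * fine (nu [set 0]) + f pi * fine (nu [set pi]))%R.
Proof.
move=> mf fM.
have int (D : set (measurableTypeR R)) : measurable D -> nu.-integrable D (EFin \o f).
  by move=> mD; apply: (bounded_integrable _ _ _ _ M).
have s1 (a : R) : \int[nu]_(t in [set a]) f t = f a * fine (nu [set a]).
  rewrite -Rintegral_cst//; apply: eq_Rintegral => t; rewrite inE => ->//.
have p0 := pi_gt0 R.
have -> : circle R = `](- pi)%R, 0%R[ `|` (`]0%R, (pi : R)[ `|` ([set 0] `|` [set pi])).
  apply/seteqP; split => t; rewrite /circle/= !in_itv/=.
    move=> /andP[t1]; rewrite le_eqVlt => /predU1P[->|t2]; first by right; right; right.
    case: (ltgtP t 0) => [t0|t0|->]; [left|right; left|by right; right; left].
      by rewrite t1.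
    exact/andP.
  move=> [/andP[-> t0]|[/andP[t0 /ltW ->]|[->|->]]].
  - by rewrite (le_trans (ltW t0) (ltW p0)).
  - by rewrite andbT (lt_trans _ t0)// oppr_lt0.
  - by rewrite oppr_lt0 p0 ltW.
  - by rewrite lexx andbT; lra.
have mI (a b : R) : measurable (`]a, b[%classic : set (measurableTypeR R)) by exact: measurable_itv.
have m1 (a : R) : measurable ([set a] : set (measurableTypeR R)) by exact: measurable_set1.
rewrite Rintegral_setU//; last 3 first.
- by apply: measurableU => //; exact: measurableU.
- by apply: int; apply: measurableU => //; apply: measurableU => //; exact: measurableU.
- apply/disj_set2P/seteqP; split => // t [] /=; rewrite !in_itv/= => /andP[a1 a2].
  by move=> [/andP[]|[]]; lra.
rewrite Rintegral_setU//; last 3 first.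
- exact: measurableU.
- by apply: int; apply: measurableU => //; apply: measurableU.
- apply/disj_set2P/seteqP; split => // t [] /=; rewrite !in_itv/= => /andP[a1 a2].
  by move=> []; lra.
rewrite Rintegral_setU//; last 2 first.
- by apply: int; apply: measurableU.
- by apply/disj_set2P/seteqP; split => // t [] /= ->; lra.
by rewrite !s1 !addrA.
Qed.

End traces.

(** * A measure plus two atoms, as a probability *)

Section two_atoms.
Local Open Scope ereal_scope.
Variable R : realType.

Lemma integral_support (m : {measure set (measurableTypeR R) -> \bar R})
    (D : set (measurableTypeR R)) (f : R -> \bar R) :
  measurable D -> m (~` D) = 0 -> measurable_fun [set: R] f ->
  \int[m]_x f x = \int[m]_(x in D) f x.
Proof.
move=> mD mD0 mf; rewrite [RHS]integral_mkcond; apply: ae_eq_integral => //.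
  by apply/(measurable_restrictT _ mD)/measurable_funTS.
exists (~` D); split => //; first exact: measurableC.
move=> x /= H Dx; apply: H => _.
by rewrite patchE mem_set.
Qed.

Lemma exists_two_atoms (m : {finite_measure set (measurableTypeR R) -> \bar R}) (u v : R) :
    (0 <= u)%R -> (0 <= v)%R -> u%:E + v%:E + m setT = 1 ->
  exists mu : probability (measurableTypeR R) R,
    (forall B, mu B = u%:E * dirac (0%R : R) B + v%:E * dirac (1%R : R) B + m B) /\
    forall f : R -> \bar R, measurable_fun [set: R] f ->
      (forall x : R, `[0%R, 1%R]%classic x -> 0 <= f x) ->
      \int[mu]_(x in `[0%R, 1%R]) f x =
        u%:E * f 0%R + v%:E * f 1%R + \int[m]_(x in `[0%R, 1%R]) f x.
Proof.
move=> u0 v0 uvm.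
pose d0 : {measure set (measurableTypeR R) -> \bar R} := mscale (NngNum u0) (dirac (0%R : measurableTypeR R)).
pose d1 : {measure set (measurableTypeR R) -> \bar R} := mscale (NngNum v0) (dirac (1%R : measurableTypeR R)).
pose s1 : {measure set (measurableTypeR R) -> \bar R} := measure_add d0 d1.
pose s : {measure set (measurableTypeR R) -> \bar R} := measure_add s1 m.
have sE B : s B = u%:E * dirac (0%R : R) B + v%:E * dirac (1%R : R) B + m B.
  by rewrite [LHS](measure_addE s1 m) [X in X + _](measure_addE d0 d1).
have sT : s setT = 1 by rewrite sE !diracT !mule1.
pose sprob := Measure_isProbability.Build _ _ _ s sT.
exists (HB.pack_for (probability (measurableTypeR R) R) (Measure.sort s) sprob).
split=> [B|f mf f0]; first exact: sE.
have mI : measurable (`[0%R, 1%R]%classic : set (measurableTypeR R)) by exact: measurable_itv.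
have mfI : measurable_fun (`[0%R, 1%R]%classic : set (measurableTypeR R)) f.
  exact: measurable_funTS.
transitivity (\int[s]_(x in `[0%R, 1%R]) f x); first by [].
rewrite /s ge0_integral_measure_add// /s1 ge0_integral_measure_add//.
rewrite /d0 ge0_integral_mscale// /d1 ge0_integral_mscale//.
by rewrite !integral_dirac// !diracE !mem_set ?mul1e//= in_itv/= lexx ler01.
Qed.

End two_atoms.

(** * Two projections and the distribution of the product of their symmetries *)

Section compression.
Variables (R : realType) (A : wstarProbabilitySpace R) (p q : A).
Hypotheses (pp : is_projection p) (qp : is_projection q).
Variable nu : probability (measurableTypeR R) R.
Hypothesis hnu : unitary_spectral_distribution (symmetry_of p * symmetry_of q) nu.
Variable kappa : R -> R.
Hypothesis hkappa : is_circle_density (circle_ac_part p q nu) kappa.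

Let x := real_state p.
Let y := real_state q.

(** Since [alpha = 2 x - 1] and [beta = 2 y - 1], the constants [a] and [b] are [|x - y|] and
    [|x + y - 1|]. *)
Let densityE (B : set (measurableTypeR R)) : measurable B -> B `<=` circle R ->
  (nu B - `|x - y|%:E * dirac (pi : R) B - `|x + y - 1|%:E * dirac (0%R : R) B =
   ((2 * pi)^-1)%:E * \int[lebesgue_measure]_(t in B) (kappa t)%:E)%E.
Proof.
move=> mB BC; rewrite -(hkappa.2 B mB BC) /circle_ac_part !state_symmetry//.
rewrite -/x -/y; congr (_ - _%:E * _ - _%:E * _)%E.
  have -> : 2 * x - 1 - (2 * y - 1) = (x - y) * 2 by ring.
  by rewrite normrM [`|2|]ger0_norm// mulfK.
have -> : 2 * x - 1 + (2 * y - 1) = (x + y - 1) * 2 by ring.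
by rewrite normrM [`|2|]ger0_norm// mulfK.
Qed.

Let sub_circle (t : R) : 0 <= t <= pi -> circle R t.
Proof. by rewrite /circle/= in_itv/= => /andP[t0 ->]; have := pi_gt0 R; rewrite andbT; lra. Qed.

Let nu_fin (B : set (measurableTypeR R)) : measurable B -> nu B \is a fin_num.
Proof. by move=> mB; exact: fin_num_measure. Qed.

(** A singleton is Lebesgue null, so the part with density does not contribute. *)
Let atom0 : nu [set 0] = `|x + y - 1|%:E.
Proof.
have m0 : measurable ([set 0 : R] : set (measurableTypeR R)) by exact: measurable_set1.
have := densityE [set 0] m0.
have dpi : dirac (pi : R) [set 0 : R] = 0%E :> \bar R.
  by rewrite diracE memNset//= => /eqP; rewrite gt_eqF// pi_gt0.
have d0 : dirac (0 : R) [set 0 : R] = 1%E :> \bar R by rewrite diracE mem_set.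
rewrite integral_set1 mule0 dpi d0.
rewrite mule0 sube0 mule1 => /(_ _)/eqP; rewrite sube_eq ?nu_fin// add0e => H.
by apply/eqP/H => _ ->; apply: sub_circle; rewrite lexx ltW ?pi_gt0.
Qed.

Let atompi : nu [set pi] = `|x - y|%:E.
Proof.
have mpi : measurable ([set pi : R] : set (measurableTypeR R)) by exact: measurable_set1.
have := densityE [set pi] mpi.
have dpi : dirac (pi : R) [set pi : R] = 1%E :> \bar R by rewrite diracE mem_set.
have d0 : dirac (0 : R) [set pi : R] = 0%E :> \bar R.
  by rewrite diracE memNset//= => /esym/eqP; rewrite gt_eqF// pi_gt0.
rewrite integral_set1 mule0 dpi d0.
rewrite mule0 sube0 mule1 => /(_ _)/eqP; rewrite sube_eq ?nu_fin// add0e => H.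
by apply/eqP/H => _ ->; apply: sub_circle; rewrite lexx ltW ?pi_gt0.
Qed.

Let nu_upper (B : set (measurableTypeR R)) : measurable B ->
    B `<=` `]0%R, (pi : R)[%classic ->
  (nu B = ((2 * pi)^-1)%:E * \int[lebesgue_measure]_(t in B) (kappa t)%:E)%E.
Proof.
move=> mB BD; rewrite -densityE//; last first.
  move=> t /BD; rewrite /= in_itv/= => /andP[t0 t1].
  by apply: sub_circle; rewrite !ltW.
rewrite !diracE !memNset ?mule0 ?sube0//.
  by move=> /BD; rewrite /= in_itv/= ltxx.
by move=> /BD; rewrite /= in_itv/= ltxx andbF.
Qed.

Let half_cos_bounded n (t : R) : `|half_cos R t ^+ n| <= 1.
Proof.
have /andP[c0 c1] := half_cos_bound R t.
by rewrite ger0_norm ?exprn_ge0// exprn_ile1.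
Qed.

Let measurable_half_cosX n : measurable_fun [set: R] (fun t => half_cos R t ^+ n).
Proof. by apply: measurable_funX; exact: measurable_half_cos. Qed.

(** The sine moments over the circle vanish and the sine is 0 at both [0] and [pi], so the
    contributions of the two open halves are opposite, as [half_cos_symmetric] requires. *)
Let symmetric (E : set (measurableTypeR R)) : measurable E ->
  nu (`]0%R, pi[ `&` half_cos R @^-1` E) = nu (`]- pi, 0%R[ `&` half_cos R @^-1` E).
Proof.
apply: half_cos_symmetric => n.
have mf : measurable_fun [set: R] (fun t => half_cos R t ^+ n * sin t).
  by apply: measurable_funM => //; apply: continuous_measurable_fun; exact: continuous_sin.
have fb t : `|half_cos R t ^+ n * sin t| <= 1.
  by rewrite normrM mulr_ile1// ler_norml sin_geN1 sin_le1.
have := circle_split _ nu _ 1 mf fb; rewrite (spectral_sin_moment _ _ _ _ nu pp qp hnu).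
rewrite sin0 sinpi !mulr0 !mul0r !addr0 => /esym.
have mI (a b : R) : measurable (`]a, b[%classic : set (measurableTypeR R)) by exact: measurable_itv.
have int (D : set (measurableTypeR R)) : measurable D ->
    nu.-integrable D (EFin \o (fun t => half_cos R t ^+ n * sin t)).
  by move=> mD; apply: (bounded_integrable _ _ _ _ 1).
move=> /eqP; rewrite addrC addr_eq0 => /eqP H.
have e1 t : half_cos R t ^+ n * (sin t / 2) = 2^-1 * (half_cos R t ^+ n * sin t) by field.
have e2 t : half_cos R t ^+ n * - (sin t / 2) = - 2^-1 * (half_cos R t ^+ n * sin t) by field.
under eq_integral do rewrite e1 EFinM.
rewrite integralZl//; last exact: int.
under [RHS]eq_integral do rewrite e2 EFinM.
rewrite integralZl//; last exact: int.
rewrite -[X in (_ * X)%E]fineK; last exact/integrable_fin_num/int.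
rewrite -[X in (_ = _ * X)%E]fineK; last exact/integrable_fin_num/int.
move: H; rewrite /Rintegral => ->.
by rewrite -!EFinM mulrN mulNr.
Qed.

Local Open Scope complex_scope.

(** The image by [half_cos] of [nu] restricted to [D], obtained with constant weight 1. *)
Let exists_half (D : set (measurableTypeR R)) : measurable D ->
  exists m : {finite_measure set (measurableTypeR R) -> \bar R},
    (forall E, measurable E -> m E = nu (D `&` half_cos R @^-1` E)) /\
    forall n, (\int[m]_(z in `[0%R, 1%R]) (z ^+ n)%:E =
               \int[nu]_(t in D) (half_cos R t ^+ n)%:E)%E.
Proof.
move=> mD.
have nuD : (nu D < +oo)%E by rewrite ltey_eq nu_fin.
have [m hm] := exists_pushforward_density _ _ R nu D (cst 1) (half_cos R) mD
  nuD (measurable_cst _) (measurable_half_cos R)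
  (fun t _ => introT andP (conj ler01 (lexx 1))).
exists m; split => [E mE|n].
  have := hm E (cst 1%E) mE (measurable_cst _) (fun _ _ => lee01).
  under [RHS]eq_integral do rewrite mule1.
  rewrite !integral_cst// ?mul1e//; apply: measurableI => //.
  by rewrite -[X in measurable X]setTI; exact: measurable_half_cos.
rewrite (hm _ (fun z => (z ^+ n)%:E)); [|exact: measurable_itv| |].
- rewrite setIidl; last by move=> t _; rewrite /= in_itv/=; exact: half_cos_bound.
  by under eq_integral do rewrite mule1.
- by apply/measurable_EFinP; apply: measurable_funX.
- by move=> z; rewrite /= in_itv/= => /andP[z0 _]; rewrite lee_fin exprn_ge0.
Qed.

(** The two open halves have the same image, whence the factor 2. [half_cos] is 1 at [0] and 0 at
    [pi], so the atom at [pi] counts only for [n = 0], where [0 ^+ 0 = 1]. *)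
Let half_mass n : \int[nu]_(t in circle R) (half_cos R t ^+ n) =
  (\int[nu]_(t in `]0%R, (pi : R)[) (half_cos R t ^+ n)) * 2 + `|x + y - 1| +
  0 ^+ n * `|x - y|.
Proof.
rewrite (circle_split _ nu _ 1 (measurable_half_cosX n) (half_cos_bounded n)).
rewrite atom0 atompi {3 4}/half_cos cos0 cospi.
have -> : (1 + 1) / 2 = 1 :> R by lra.
rewrite subrr mul0r expr1n mul1r mulrDr mulr1; congr (_ + _ + _ + _).
have mI (a b : R) : measurable (`]a, b[%classic : set (measurableTypeR R)) by exact: measurable_itv.
have [m1 [m1E m1X]] := exists_half _ (mI 0 pi).
have [m2 [m2E m2X]] := exists_half _ (mI (- pi) 0).
rewrite /Rintegral -m1X -m2X; congr fine; apply: eq_measure_integral => B mB _.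
have mm : m1 B = m2 B by rewrite m1E// m2E// symmetric.
exact: esym mm.
Qed.

(** For positive [n] this is the trace formula together with [(|s| + s) / 2 = max s 0] for
    [s = x + y - 1]. For [n = 0] it expresses that [nu] has mass 1 on the circle. *)
Let compression_moment n : (\int[nu]_(t in `]0%R, (pi : R)[) (half_cos R t ^+ n) +
    (1 - Num.min x y) * 0 ^+ n + Num.max (x + y - 1) 0)%:C = state ((p * q * p) ^+ n).
Proof.
have := half_mass n; case: n => [|n].
  rewrite !expr0 !mul1r wps_state1.
  under [LHS]eq_Rintegral do rewrite expr0.
  have [nu1 _] := hnu; rewrite Rintegral_cst; last exact: measurable_itv.
  rewrite [fine _](congr1 fine nu1) mulr1 /=.
  move=> H; congr (_ +i* _); move: H.
  have [xy|xy] := lerP x y; have [xy1|xy1] := lerP (x + y - 1) 0.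
  - by rewrite (ler0_norm xy1); lra.
  - by rewrite (gtr0_norm xy1); lra.
  - by rewrite (ler0_norm xy1); lra.
  - by rewrite (gtr0_norm xy1); lra.
rewrite !expr0n !mulr0 !mul0r !addr0 => H.
have [px _] := state_projection _ _ _ pp; have [qy _] := state_projection _ _ _ qp.
rewrite trace_compression_exp ?pp.2 ?qp.2//; last exact: wps_state_tracial.
rewrite (state_cos2_half _ _ _ _ nu pp qp hnu) H wps_state1 px qy -/x -/y.
have -> : 2 = 2%:C :> R[i] by rewrite rmorphMn.
rewrite -!rmorphD -rmorphB -fmorphV -rmorphM/=; congr (_ +i* _).
by have [xy1|xy1] := lerP (x + y - 1) 0; [rewrite (ler0_norm xy1)|rewrite (gtr0_norm xy1)]; lra.
Qed.

Let density (z : R) : R := kappa (2 * acos (Num.sqrt z)) /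
  (2 * pi * Num.sqrt (z * (1 - z))) * \1_(`[0%R, 1%R] : set R) z.

(** The candidate is the image of the upper half of the circle by [half_cos], plus atoms at 0 and 1.
    Its moments are those of [compression_moment], and [arcsine_integral] gives its density. *)
Lemma exists_compression_law : exists mu : probability (measurableTypeR R) R,
  [/\ mu (~` `[0%R, 1%R]%classic) = 0%E,
    (forall n, (\int[mu]_(z in `[0%R, 1%R]) (z ^+ n)%:E)%E \is a fin_num /\
      (\int[mu]_z (z ^+ n))%R%:C = state ((p * q * p) ^+ n)) &
    forall B : set (measurableTypeR R), measurable B ->
      mu B = ((1 - Num.min x y)%R%:E * dirac (0%R : R) B
              + (Num.max (x + y - 1) 0)%R%:E * dirac (1%R : R) B
              + \int[@lebesgue_measure R]_(z in B) (density z)%:E)%E].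
Proof.
have mI (a b : R) : measurable (`]a, b[%classic : set (measurableTypeR R)) by exact: measurable_itv.
have mII : measurable (`[0, 1]%classic : set (measurableTypeR R)) by exact: measurable_itv.
have [m [mE mX]] := exists_half _ (mI 0 pi).
have [_ /andP[x0 x1]] := state_projection _ _ _ pp.
have [_ /andP[y0 y1]] := state_projection _ _ _ qp.
have mfin n : (\int[m]_(z in `[0%R, 1%R]) (z ^+ n)%:E)%E \is a fin_num.
  rewrite mX; apply: integrable_fin_num => //.
  exact: (bounded_integrable _ _ _ _ 1).
have u0 : 0 <= 1 - Num.min x y by rewrite subr_ge0 ge_min x1.
have v0 : 0 <= Num.max (x + y - 1) 0 by rewrite le_max lexx orbT.
(* The total mass is 1 by the moment identity at exponent 0. *)
have uvm : ((1 - Num.min x y)%:E + (Num.max (x + y - 1) 0)%:E + m setT = 1)%E.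
  have mT : m setT = (\int[m]_(z in `[0%R, 1%R]) (z ^+ 0)%:E)%E.
    rewrite mX; under eq_integral do rewrite expr0.
    rewrite integral_cst// mul1e mE//; congr (nu _).
    by rewrite preimage_setT setIT.
  have /(congr1 (@complex.Re R))/= H := etrans (compression_moment 0) (wps_state1 A).
  rewrite mT -(fineK (mfin 0%N)) mX -!EFinD; congr EFin.
  by rewrite -[RHS]H /Rintegral expr0; ring.
have [mu [muE muI]] := exists_two_atoms _ m _ _ u0 v0 uvm.
have muX n : (\int[mu]_(z in `[0%R, 1%R]) (z ^+ n)%:E)%E =
    (\int[nu]_(t in `]0%R, (pi : R)[) (half_cos R t ^+ n) +
     (1 - Num.min x y) * 0 ^+ n + Num.max (x + y - 1) 0)%R%:E.
  rewrite muI.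
  - rewrite expr1n -(fineK (mfin n)) mX -!EFinM -!EFinD; congr EFin.
    by rewrite /Rintegral; ring.
  - by apply/measurable_EFinP; apply: measurable_funX.
  - by move=> z; rewrite /= in_itv/= => /andP[z0 _]; rewrite lee_fin exprn_ge0.
have mu01 : mu (~` `[0%R, 1%R]%classic) = 0%E.
  rewrite muE !diracE !memNset/= ?mule0 ?add0e; last 2 first.
  - by rewrite in_itv/= lexx ler01; apply.
  - by rewrite in_itv/= lexx ler01; apply.
  rewrite mE; last exact: measurableC.
  rewrite (_ : _ `&` _ = set0) ?measure0//; apply/seteqP; split => // t [_].
  by apply; rewrite /= in_itv/=; exact: half_cos_bound.
exists mu; split => // [n|].
  split; first by rewrite muX.
  rewrite -compression_moment /Rintegral (integral_support _ mu _ _ mII mu01) ?muX//.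
  by apply/measurable_EFinP; apply: measurable_funX.
move=> B mB; rewrite muE; congr (_ + _)%E; rewrite mE//.
rewrite nu_upper; last 2 first.
- by apply: measurableI => //; rewrite -[X in measurable X]setTI; exact: measurable_half_cos.
- by move=> t [].
by rewrite /density arcsine_integral//; exact: hkappa.1.
Qed.

(** Any spectral distribution has compact support and the same moments as the candidate, hence
    equals it by [moments_unique]. *)
Lemma compression_law :
  (exists mu : probability (measurableTypeR R) R,
     self_adjoint_spectral_distribution (p * q * p) mu) /\
  forall mu : probability (measurableTypeR R) R,
    self_adjoint_spectral_distribution (p * q * p) mu ->
    forall B : set (measurableTypeR R), measurable B ->
      mu B = ((1 - Num.min x y)%R%:E * dirac (0%R : R) B
              + (Num.max (x + y - 1) 0)%R%:E * dirac (1%R : R) B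
              + \int[@lebesgue_measure R]_(z in B) (density z)%:E)%E.
Proof.
have [mu0 [mu01 mu0X mu0E]] := exists_compression_law.
have mI (a b : R) : measurable (`[a, b]%classic : set (measurableTypeR R)) by exact: measurable_itv.
split.
  exists mu0; split; last by move=> n; have [] := mu0X n.
  exists 1; have m11 := mI (- 1) 1.
  rewrite -[X in mu0 X]setCK probability_setC; last exact: measurableC.
  rewrite (subset_measure0 (B := ~` `[0, 1]%classic) (mu := mu0)) ?sube0//.
  - exact: measurableC.
  - exact: measurableC.
  - by apply: subsetC => z; rewrite /= !in_itv/= => /andP[z0 ->]; rewrite andbT; lra.
move=> mu [[M muM] muX] B mB; rewrite -mu0E//.
(* [[- N, N]] contains both [[- M, M]] and [[0, 1]], hence carries both measures, and it is
   nondegenerate. *)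
pose N := Num.max M 1.
have out (m : probability (measurableTypeR R) R) (D : set (measurableTypeR R)) :
  measurable D -> D `<=` `[- N, N]%classic -> m (~` D) = 0%E -> m (~` `[- N, N]%classic) = 0%E.
  move=> mD DN mD0; apply: (subset_measure0 (B := ~` D)) => //.
  - exact: measurableC.
  - exact: measurableC.
  - exact: subsetC.
have muN : mu (~` `[- N, N]%classic) = 0%E.
  apply: (out _ `[- M, M]%classic) => //.
    move=> z; rewrite /= !in_itv/= => /andP[z0 z1].
    by rewrite le_max z1 andbT lerNl le_max lerNl z0.
  by rewrite probability_setC// muM subee.
have mu0N : mu0 (~` `[- N, N]%classic) = 0%E.
  apply: (out _ `[0, 1]%classic) => //.
  move=> z; rewrite /= !in_itv/= => /andP[z0 z1].
  by rewrite le_max z1 orbT andbT (le_trans _ z0)// oppr_le0 (le_trans ler01)// le_max lexx orbT.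
have N0 : 0 < N by rewrite /N lt_max ltr01 orbT.
apply: (moments_unique _ mu mu0 (- N) N) => // [|n]; first lra.
have mXn : measurable_fun [set: R] (fun z : R => (z ^+ n)%:E).
  by apply/measurable_EFinP; apply: measurable_funX.
have fin (m : probability (measurableTypeR R) R) :
    (\int[m]_(z in `[(- N)%R, N]) (z ^+ n)%:E)%E \is a fin_num.
  apply: integrable_fin_num => //.
  have := horner_integrable _ m 'X^n (- N) N.
  rewrite (_ : (fun _ => _) = (fun z => (z ^+ n)%:E))//.
  by apply/funext => z; rewrite !hornerE.
rewrite -[LHS]fineK ?fin// -[RHS]fineK ?fin//; congr EFin.
rewrite -(integral_support _ mu _ _ (mI _ _) muN mXn).
rewrite -(integral_support _ mu0 _ _ (mI _ _) mu0N mXn).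
by have [_] := mu0X n; rewrite -muX => /complexI.
Qed.

End compression.

Theorem theorem1p1 (R : realType) (A : wstarProbabilitySpace R)
    (P Q : A) (U : R -> A)
    (hP : is_projection P) (hQ : is_projection Q)
    (hU : free_unitary_brownian_motion U)
    (hfree : forall s : R, 0 <= s ->
       free_pair [set P; Q] [set U s; vn_star (U s)])
    (t : R) (ht : 0 < t)
    (nu : probability (measurableTypeR R) R)
    (hnu : unitary_spectral_distribution
       (symmetry_of P * U t * symmetry_of Q * vn_star (U t)) nu)
    (kappa : R -> R)
    (hkappa : is_circle_density (circle_ac_part P Q nu) kappa) :
  let X := P * U t * Q * vn_star (U t) * P in
  let p := real_state P in
  let q := real_state Q in
  (exists mu : probability (measurableTypeR R) R,
     self_adjoint_spectral_distribution X mu) /\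
  forall mu : probability (measurableTypeR R) R,
    self_adjoint_spectral_distribution X mu ->
    forall B : set (measurableTypeR R), measurable B ->
      mu B = ((1 - Num.min p q)%R%:E * dirac (0%R : R) B
              + (Num.max (p + q - 1) 0)%R%:E * dirac (1%R : R) B
              + \int[@lebesgue_measure R]_(x in B)
                  (kappa (2 * acos (Num.sqrt x)) / (2 * pi * Num.sqrt (x * (1 - x)))
                   * \1_(`[0%R, 1%R] : set R) x)%:E)%E.
Proof.
have [[/(_ t (ltW ht)) uU _] _ _ _] := hU.
have hQ' := projection_conj _ _ _ _ uU hQ.
set Q' := U t * Q * vn_star (U t) in hQ'.
(* Traciality and unitarity of [U t]: conjugation preserves the trace. *)
have qE : real_state Q' = real_state Q.
  by rewrite /real_state /Q' -mulrA wps_state_tracial -mulrA uU.1 mulr1.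
have SE : U t * symmetry_of Q * vn_star (U t) = symmetry_of Q'.
  by rewrite /symmetry_of mulrBr mulr1 mulrBl uU.2 -scalerAr -scalerAl.
have VE : symmetry_of P * U t * symmetry_of Q * vn_star (U t) = symmetry_of P * symmetry_of Q'.
  by rewrite -SE !mulrA.
rewrite VE in hnu.
(* The subtracted atoms depend on the projections only through their traces. *)
have kE : circle_ac_part P Q nu = circle_ac_part P Q' nu.
  by apply/funext => B; rewrite /circle_ac_part !state_symmetry// qE.
rewrite kE in hkappa.
have -> : P * U t * Q * vn_star (U t) * P = P * Q' * P by rewrite /Q' !mulrA.
by rewrite /= -qE; exact: compression_law hP hQ' nu hnu kappa hkappa.
Qed.
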